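(* Let $s,q,a,t$ be integers satisfying $a\ge 2$, $q=a\binom{s}{2}-t$ and either (a) $s\ge 2$ and $t=1$, or (b) $s\ge 4$ and $2\le t\le\frac{s}{2}$. (Extremal) Then for all $n\ge s$, $\mathbb{T}_{s-t,a}(n)\subseteq\mathcal{P}(n,s,q)$ and $\operatorname{ex}_{\Pi}(n,s,q)=(a-1)^{\binom{n}{2}}\big(\frac{a}{a-1}\big)^{t_{s-t}(n)}$, and $\operatorname{ex}_{\Pi}(s,q)=(a-1)\big(\frac{a}{a-1}\big)^{\frac{s-t-1}{s-t}}$. If (a) holds and $n\ge s$, or (b) holds and $n$ is sufficiently large, then $\mathcal{P}(n,s,q)=\mathbb{T}_{s-t,a}(n)$. (Stability) For all $\delta>0$ there are $M$ and $\epsilon>0$ such that for all $n>M$ and $G\in F(n,s,q)$, if $P(G)>\operatorname{ex}_{\Pi}(n,s,q)^{1-\epsilon}$, then $G$ is $\delta$-close to an element of $\mathbb{T}_{s-t,a}(n)$.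
   Context: For a set $X$ and a positive integer $t$, $\binom{X}{t}$ is the set of $t$-element subsets of $X$; $[n]=\{1,\dots,n\}$; $\mathbb{N}=\{0,1,2,\dots\}$. A multigraph is a pair $G=(V,w)$ where $V$ is a (finite) set of vertices and $w:\binom{V}{2}\to\mathbb{N}$. For integers $s\ge 2$, $q\ge 0$, $G=(V,w)$ is an $(s,q)$-graph if $\sum_{xy\in\binom{X}{2}}w(xy)\le q$ for every $X\in\binom{V}{s}$. $F(n,s,q)$ is the set of $(s,q)$-graphs with vertex set $[n]$. Let $P(G)=\prod_{xy\in\binom{V}{2}}w(xy)$, $\operatorname{ex}_{\Pi}(n,s,q)=\max\{P(G):G\in F(n,s,q)\}$ for $n\ge s$, and $\mathcal{P}(n,s,q)=\{G\in F(n,s,q):P(G)=\operatorname{ex}_{\Pi}(n,s,q)\}$. $\operatorname{ex}_{\Pi}(s,q)=\lim_{n\to\infty}\operatorname{ex}_{\Pi}(n,s,q)^{1/\binom{n}{2}}$. Two multigraphs $G=(V,w)$, $G'=(V,w')$ with $|V|=n$ are $\delta$-close if $|\{xy\in\binom{V}{2}:w(xy)\ne w'(xy)\}|\le\delta n^2$. A partition $U_1,\dots,U_k$ of a finite set is an equipartition if $||U_i|-|U_j||\le 1$ for all $i\ne j$. For integers $a\ge 2$ and $n\ge r\ge 1$, $\mathbb{T}_{r,a}(n)$ is the set of multigraphs $G=([n],w)$ for which there is an equipartition $U_1,\dots,U_r$ of $[n]$ with $w(xy)=a-1$ if $xy\in\binom{U_i}{2}$ for some $i$, and $w(xy)=a$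 if $x\in U_i$, $y\in U_j$ for some $i\ne j$. $t_r(n)$ is the number of edges of the Turán graph $T_r(n)$, the complete $r$-partite graph on $n$ vertices whose parts form an equipartition. *)

(* Defs.v *)
(* MathComp + MathComp-Analysis. *)
From HB Require Import structures.
From mathcomp Require Import all_boot all_order all_algebra.
From mathcomp Require Import all_classical all_reals all_analysis.

Set Implicit Arguments.
Unset Strict Implicit.
Unset Printing Implicit Defensive.

Import Order.TTheory GRing.Theory Num.Theory.
Import numFieldNormedType.Exports.

Local Open Scope classical_set_scope.
Local Open Scope nat_scope.

Definition edge (V : finType) := {e : {set V} | #|e| == 2}.

Definition multigraph (V : finType) := {ffun edge V -> nat}.

Definition sq_graph (V : finType) (s q : nat) (G : multigraph V) : Prop :=
  forall X : {set V}, #|X| = s -> \sum_(e : edge V | val e \subset X) G e <= q.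

Definition edge_prod (V : finType) (G : multigraph V) : nat :=
  \prod_(e : edge V) G e.

(* The vertex set [n] is represented by 'I_n = {0, ..., n-1}. *)
Definition sq_graphs (n s q : nat) : set (multigraph 'I_n) :=
  [set G : multigraph 'I_n | sq_graph s q G].
Arguments sq_graphs : clear implicits.

(* The value is 0 if A has no maximum. *)
Definition set_max (A : set nat) : nat :=
  xget 0 [set m | A m /\ forall k, A k -> k <= m].

(* Meaningful for 2 <= s <= n: every pair then lies in some s-set, so all the
   weights are at most q and the maximum exists. *)
Definition ex_prod (n s q : nat) : nat :=
  set_max [set edge_prod G | G in sq_graphs n s q].

Definition extremal_graphs (n s q : nat) : set (multigraph 'I_n) :=
  [set G : multigraph 'I_n | sq_graphs n s q G /\ edge_prod G = ex_prod n s q].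
Arguments extremal_graphs : clear implicits.

(* The exponent is 1 / 'C(n, 2). *)
Definition ex_prod_root (R : realType) (s q : nat) : nat -> R :=
  fun n => ((ex_prod n s q)%:R `^ ('C(n, 2)%:R)^-1)%R.

Definition ex_prod_lim (R : realType) (s q : nat) : R :=
  limn (ex_prod_root R s q).

Definition delta_close (R : realType) (V : finType) (delta : R)
    (G H : multigraph V) : Prop :=
  (#|[pred e : edge V | G e != H e]|%:R <= delta * #|V|%:R ^+ 2)%R.

(* The parts of a [partition] are nonempty. This is no restriction for r <= n,
   as an equipartition of n >= r points into r parts has no empty part. *)
Definition equipartition (V : finType) (r : nat) (P : {set {set V}}) : Prop :=
  [/\ finset.partition P [set: V]%SET, #|P| = r &
      forall U W, U \in P -> W \in P -> #|U| <= #|W| + 1].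

Definition crossing (V : finType) (P : {set {set V}}) (e : edge V) : bool :=
  [exists U in P, exists W in P,
    [&& U != W, ~~ [disjoint val e & U] & ~~ [disjoint val e & W]]].

Definition turan_multigraphs (r a n : nat) : set (multigraph 'I_n) :=
  [set G : multigraph 'I_n | exists P : {set {set 'I_n}}, [/\ equipartition r P,
     forall (U : {set 'I_n}) (e : edge 'I_n),
       U \in P -> val e \subset U -> G e = a - 1 &
     forall e : edge 'I_n, crossing P e -> G e = a]].
Arguments turan_multigraphs : clear implicits.

(* The Turan graph is realized with the residue classes modulo r as parts; they
   form an equipartition of 'I_n into r parts when 1 <= r <= n. *)
Definition turan_edges (r n : nat) : nat :=
  #|[pred e : edge 'I_n |
      crossing (preim_partition (fun x : 'I_n => x %% r) [set: 'I_n]%SET) e]|.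

(* Main.v *)
Require Import Defs.
From HB Require Import structures.
From mathcomp Require Import all_boot all_order all_algebra.
From mathcomp Require Import all_classical all_reals all_analysis.
From mathcomp Require Import perm fingroup.
From mathcomp Require Import zify ring lra.

Set Implicit Arguments.
Unset Strict Implicit.
Unset Printing Implicit Defensive.

Import Order.TTheory GRing.Theory Num.Theory.
Import numFieldNormedType.Exports.

(** Every multigraph is compared with the weight [a - 1]: with
    [u x y = w x y - (a - 1)] and [r = s - t], the hypothesis says that a set of
    [r + t] vertices carries at most [C(r + t, 2) - t] units of [u], which is what
    the complete balanced [r]-partite graph has there.

    Sums. Averaging over the deletion of one vertex shows by induction that the
    total of [u] on [m >= s] vertices is at most the number of edges of the Turan
    graph with [r] parts ([wsum_le_turan2]); the rounding in the induction is
    favourable because all weights are integers ([turan2_average]). No upper bound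
    on the individual weights is needed.

    Products. On the integers, the logarithm lies below the secant line through
    [a - 1] and [a], and strictly below it by a fixed amount elsewhere
    ([ln_weight_le]). Summing over the edges, the bound on sums gives the bound on
    products, and the deficit of [ln P(G)] controls both the deficit of the sum and
    the number of weights other than [a - 1] and [a] ([ln_edge_prod_deficit]).
    Turan multigraphs attain the bound, which gives the extremal number and its
    limit.

    Uniqueness. An extremal multigraph therefore only has the weights [a - 1] and
    [a], and the graph of the edges of weight [a] has as many edges as the Turan
    graph. If [t = 1] it has no clique on [r + 1] vertices, and the case of equality
    in Turan's theorem applies ([turan_unique]). If [2 <= t <= r], its minimum degree
    is about [(1 - 1/r) n]; for large [n] a clique on [r + 1] vertices could then be
    enlarged greedily to [r + t] vertices, each new vertex missing at most one unit
    of weight, against the hypothesis ([no_dense_set]). So there is no such clique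
    and Turan's theorem applies again.

    Stability. The weights other than [a - 1] and [a] receive a large penalty. A set
    [A] of vertices maximizing its penalized weight, counted on ordered pairs, minus
    [(1 - 1/r - g) |A|^2] contains almost all vertices and has a large minimum degree
    ([exists_min_degree]). As before it contains no clique on [r + 1] vertices, but it
    contains a clique on [r] vertices. Almost every vertex of [A] is joined to all
    vertices of this clique but one; that one sorts the vertices into [r] independent
    classes of nearly equal sizes, between which almost all pairs are joined
    ([near_turan]). A balanced colouring agreeing with these classes as much as
    possible is obtained by permuting the vertices ([balanced_recolor]). *)

Local Open Scope ring_scope.

(** * Edges and ordered pairs *)

(** The function on ordered pairs induced by a function on edges; it vanishes
    on the diagonal. *)
Definition pair_fun (M : nmodType) (V : finType) (f : edge V -> M) (x y : V) : M :=
  oapp f 0 (insub [set x; y]%SET).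

Lemma edge_witness (V : finType) (e : edge V) :
  {p : V * V | p.1 != p.2 & val e = [set p.1; p.2]%SET}.
Proof.
have h : exists p : V * V, (p.1 != p.2) && (val e == [set p.1; p.2]%SET).
  have /cards2P [x [y [xy ->]]] := valP e.
  by exists (x, y); rewrite /= xy eqxx.
by have [p1 /eqP p2] := andP (xchooseP h); exists (xchoose h).
Qed.

Section PairFun.
Variables (M : nmodType) (V : finType) (f : edge V -> M).

Lemma pair_fun_sym x y : pair_fun f x y = pair_fun f y x.
Proof. by rewrite /pair_fun finset.setUC. Qed.

Lemma pair_fun_diag x : pair_fun f x x = 0.
Proof. by rewrite /pair_fun insubF // finset.setUid cards1. Qed.

Lemma pair_fun_edge x y e : val e = [set x; y]%SET -> pair_fun f x y = f e.
Proof. by move=> h; rewrite /pair_fun -h valK. Qed.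

Lemma pair_funP x y : x != y ->
  exists2 e : edge V, val e = [set x; y]%SET & pair_fun f x y = f e.
Proof.
move=> xy; have h : #|[set x; y]%SET| == 2%N by rewrite cards2 xy.
by exists (exist (fun e : {set V} => #|e| == 2%N) [set x; y]%SET h) => //; apply: pair_fun_edge.
Qed.

(** Each edge comes from exactly two ordered pairs. *)
Lemma sum_pair_fun (X : {set V}) :
  \sum_(x in X) \sum_(y in X) pair_fun f x y =
  (\sum_(e : edge V | val e \subset X) f e) *+ 2.
Proof.
rewrite pair_big /=.
rewrite (bigID (fun p : V * V => p.1 == p.2)) /= big1 ?add0r; last first.
  by move=> [x y] /= /andP[_ /eqP ->]; rewrite pair_fun_diag.
pose g (p : V * V) : option (edge V) := insub [set p.1; p.2]%SET.
rewrite -sumrMnl.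
transitivity (\sum_(e : edge V | val e \subset X)
   \sum_(p : V * V | [&& p.1 \in X, p.2 \in X & p.1 != p.2] && (g p == Some e)) f e).
  rewrite (exchange_big_dep (fun p : V * V => [&& p.1 \in X, p.2 \in X & p.1 != p.2])) /=; last first.
    by move=> e p _ /andP[].
  apply: eq_big => [p|p /andP[/andP[pX qX] pq]]; first by rewrite -andbA.
  have [e he hf] := pair_funP pq.
  rewrite hf (big_pred1 e) // => e'.
  rewrite /g -he valK /= pX qX pq /=.
  apply/andP/eqP => [[_ /eqP[]] //|->]; split; last by [].
  by rewrite he finset.subUset !finset.sub1set pX.
apply: eq_bigr => e eX.
have [[x y] xy he] := edge_witness e; rewrite [(x, y).1]/= [(x, y).2]/= in xy he.
rewrite (bigD1 (x, y)) /=; last first.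
  rewrite xy /g /= -he valK eqxx !andbT.
  by move: eX; rewrite he finset.subUset !finset.sub1set.
rewrite (big_pred1 (y, x)) ?mulr2n // => -[x' y'] /=.
rewrite /g /=; apply/idP/eqP => [|[-> ->]].
  move=> /andP[/andP[/and3P[_ _ xy'] /eqP h] ne].
  have {}h : [set x'; y']%SET = [set x; y]%SET.
    rewrite -he; move: h; case: insubP => // e' _ <- [->] //.
  have : x' \in [set x; y]%SET by rewrite -h !inE eqxx.
  have : y' \in [set x; y]%SET by rewrite -h !inE eqxx orbT.
  rewrite !inE => /orP[] /eqP hy /orP[] /eqP hx; subst; rewrite ?eqxx // in xy' ne *.
have := eX; rewrite he finset.subUset !finset.sub1set => /andP[-> ->] /=.
rewrite eq_sym xy /= finset.setUC -he valK eqxx /=.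
by apply/eqP => -[] h; rewrite h eqxx in xy.
Qed.

Lemma sum_pair_funT :
  \sum_x \sum_y pair_fun f x y = (\sum_(e : edge V) f e) *+ 2.
Proof.
have := sum_pair_fun [set: V]%SET.
under eq_bigl do rewrite finset.in_setT.
under eq_bigr do under eq_bigl do rewrite finset.in_setT.
by move=> ->; congr (_ *+ _); apply: eq_bigl => e; rewrite finset.subsetT.
Qed.

End PairFun.

Lemma card_edge (V : finType) : #|{: edge V}| = 'C(#|V|, 2).
Proof. by rewrite card_sig -card_draws; apply: eq_card => A; rewrite !inE. Qed.

(** * The Turan number *)

(** Twice the number of edges of the Turan graph on [m] vertices with [r] parts:
    [m ^ 2] minus the sum of the squares of the sizes of the parts, [m %% r] of
    which have size [m %/ r + 1], the others [m %/ r]. *)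
Definition turan2 (r m : nat) : int :=
  m%:Z * m%:Z - (m %/ r)%N%:Z * m%:Z - (m %% r)%N%:Z * ((m %/ r)%N%:Z + 1).

Lemma turan2S r m : (0 < r)%N ->
  turan2 r m.+1 = turan2 r m + (m%:Z - (m %/ r)%N%:Z) *+ 2.
Proof.
move=> r0; rewrite /turan2.
have hm := divn_eq m r; have hj := ltn_pmod m r0.
set p := (m %/ r)%N in hm *; set j := (m %% r)%N in hm hj *.
have [jr|jr] := ltnP j.+1 r.
  have hm' : m.+1 = (p * r + j.+1)%N by lia.
  have -> : (m.+1 %/ r = p)%N by rewrite hm' divnMDl // divn_small // addn0.
  have -> : (m.+1 %% r = j.+1)%N by rewrite hm' modnMDl modn_small.
  lia.
have ej : j = r.-1 by lia.
have hm' : m.+1 = (p.+1 * r)%N by lia.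
have -> : (m.+1 %/ r = p.+1)%N by rewrite hm' mulnK.
have -> : (m.+1 %% r = 0)%N by rewrite hm' modnMl.
have hj' : j%:Z = r%:Z - 1 by lia.
have hz : m%:Z + 1 = (p%:Z + 1) * r%:Z by lia.
nia.
Qed.

Lemma turan2_even r m : (0 < r)%N -> exists k : int, turan2 r m = k *+ 2.
Proof.
move=> r0; elim: m => [|m [k hk]].
  by exists 0; rewrite /turan2 div0n mod0n.
by rewrite turan2S // hk -mulrnDl; eexists.
Qed.

(** If all sets of [k] vertices of a graph on [k + 1] vertices obey the Turan bound,
    the graph obeys it too: by this inequality, the average over these sets excludes
    one more edge. *)
Lemma turan2_average r k : (r < k)%N -> (0 < r)%N ->
  k.+1%:Z * turan2 r k < (k%:Z - 1) * (turan2 r k.+1 + 2).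
Proof.
move=> rk r0; rewrite turan2S //.
suff h : turan2 r k < (k%:Z - 1) * (k%:Z - (k %/ r)%N%:Z + 1) by lia.
rewrite /turan2.
have hm := divn_eq k r; have hj := ltn_pmod k r0.
set p := (k %/ r)%N in hm *; set j := (k %% r)%N in hm hj *.
have p1 : (0 < p)%N by nia.
have pj : (1 < p)%N \/ (0 < j)%N.
  case: (ltnP 1 p) => h; [by left | right].
  have ep : p = 1%N by lia.
  by rewrite ep in hm; lia.
nia.
Qed.

(** The minimum degree of the Turan graph is the integral part of its average
    degree. *)
Lemma turan2_average_deg r m : (0 < r)%N ->
  turan2 r m.+1 < m.+1%:Z * (m%:Z - (m %/ r)%N%:Z + 1).
Proof. by move=> r0; rewrite turan2S // /turan2; nia. Qed.

Lemma turan2_le r m : (0 < r)%N ->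
  r%:Z * turan2 r m <= (r%:Z - 1) * (m%:Z * m%:Z).
Proof.
move=> r0; rewrite /turan2.
have hm := divn_eq m r; have hj := ltn_pmod m r0.
set p := (m %/ r)%N in hm *; set j := (m %% r)%N in hm hj *.
have hz : m%:Z = p%:Z * r%:Z + j%:Z by lia.
have -> : r%:Z * (m%:Z * m%:Z - p%:Z * m%:Z - j%:Z * (p%:Z + 1)) =
   (r%:Z - 1) * (m%:Z * m%:Z) - j%:Z * (r%:Z - j%:Z) by rewrite hz; ring.
nia.
Qed.

Lemma turan2_ge r m : (0 < r)%N ->
  (r%:Z - 1) * (m%:Z * m%:Z) - r%:Z * r%:Z <= r%:Z * turan2 r m.
Proof.
move=> r0; rewrite /turan2.
have hm := divn_eq m r; have hj := ltn_pmod m r0.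
set p := (m %/ r)%N in hm *; set j := (m %% r)%N in hm hj *.
have hz : m%:Z = p%:Z * r%:Z + j%:Z by lia.
have -> : r%:Z * (m%:Z * m%:Z - p%:Z * m%:Z - j%:Z * (p%:Z + 1)) =
   (r%:Z - 1) * (m%:Z * m%:Z) - j%:Z * (r%:Z - j%:Z) by rewrite hz; ring.
nia.
Qed.

Lemma turan2_small r m : (m <= r)%N -> (0 < r)%N -> turan2 r m = m%:Z * (m%:Z - 1).
Proof.
rewrite leq_eqVlt => /predU1P[-> r0|mr r0]; rewrite /turan2.
  by rewrite divnn r0 modnn /=; lia.
by rewrite divn_small // modn_small //; lia.
Qed.

(** The value at [r + t] vertices, where [t] parts have one more vertex. *)
Lemma turan2_base r t : (t <= r)%N -> (0 < r)%N ->
  turan2 r (r + t) = (r + t)%N%:Z * ((r + t)%N%:Z - 1) - t%:Z *+ 2.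
Proof.
rewrite leq_eqVlt => /predU1P[-> r0|mr r0]; rewrite /turan2.
  rewrite addnn -mul2n mulnK // modnMl; lia.
rewrite divnDl ?dvdnn // divnn r0 (divn_small mr) addn0 modnDl modn_small //; lia.
Qed.

(** * Weights on ordered pairs *)

(** The total weight of a vertex towards a set, and the total weight of the
    ordered pairs inside a set (twice the weight of the edges). *)
Definition deg_in (V : finType) (u : V -> V -> int) (x : V) (A : {set V}) : int :=
  \sum_(y in A) u x y.

Definition wsum (V : finType) (u : V -> V -> int) (A : {set V}) : int :=
  \sum_(x in A) deg_in u x A.

Section Weights.
Variables (V : finType) (u : V -> V -> int).
Hypothesis u_sym : forall x y, u x y = u y x.
Hypothesis u_diag : forall x, u x x = 0.
Implicit Types (A Q : {set V}) (x y : V).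

Lemma deg_inD1 x y A : y \in A -> deg_in u x A = u x y + deg_in u x (A :\ y).
Proof. by move=> yA; rewrite /deg_in (big_setD1 y yA). Qed.

Lemma wsumD1 x A : x \in A -> wsum u A = wsum u (A :\ x) + deg_in u x A *+ 2.
Proof.
move=> xA; rewrite {1}/wsum (big_setD1 x xA) /=.
under eq_bigr do rewrite (deg_inD1 _ xA).
rewrite big_split /= -/(wsum u (A :\ x)).
have -> : \sum_(i in A :\ x) u i x = deg_in u x A.
  rewrite (deg_inD1 x xA) u_diag add0r.
  by apply: eq_bigr => i _; rewrite u_sym.
by rewrite addrA -mulr2n addrC.
Qed.

Lemma wsumU1 x Q : x \notin Q -> wsum u (x |: Q) = wsum u Q + deg_in u x Q *+ 2.
Proof.
move=> xQ; rewrite (@wsumD1 x) ?setU11 // setU1K //.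
by rewrite (deg_inD1 x (setU11 x Q)) u_diag add0r setU1K.
Qed.

Lemma wsum_even A : exists k : int, wsum u A = k *+ 2.
Proof.
move: {2}(#|A|) (erefl #|A|) => n; elim: n A => [|n IH] A cA.
  by exists 0; rewrite /wsum big1 // => x; rewrite (cards0_eq cA) finset.in_set0.
have [x xA] : exists x, x \in A by apply/card_gt0P; rewrite cA.
have [|k hk] := IH (A :\ x); first by move: cA; rewrite (cardsD1 x) xA => -[].
by rewrite (wsumD1 xA) hk -mulrnDl; eexists.
Qed.

(** Averaging over the deletion of one vertex. *)
Lemma sum_wsumD1 A :
  \sum_(x in A) wsum u (A :\ x) = (#|A|%:Z - 2) * wsum u A.
Proof.
have -> : \sum_(x in A) wsum u (A :\ x) =
   \sum_(x in A) (wsum u A - deg_in u x A *+ 2).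
  by apply: eq_bigr => x xA; rewrite (wsumD1 xA) addrK.
rewrite big_split /= sumr_const sumrN sumrMnl -/(wsum u A).
by rewrite mulrBl -mulr_natl; lia.
Qed.

(** The sum version of the extremal problem: if every [r + t] vertices carry at
    most the weight of a Turan graph, then so does every larger set. *)
Lemma wsum_le_turan2 (r t : nat) : (0 < r)%N -> (0 < t <= r)%N ->
  (forall X : {set V}, #|X| = (r + t)%N ->
     wsum u X <= (r + t)%N%:Z * ((r + t)%N%:Z - 1) - t%:Z *+ 2) ->
  forall A, (r + t <= #|A|)%N -> wsum u A <= turan2 r #|A|.
Proof.
move=> r0 /andP[t0 tr] H A.
move: {2}(#|A|) (erefl #|A|) => n; elim: n A => [|n IH] A cA hn; first lia.
move: hn; rewrite leq_eqVlt => /predU1P[hn|hn].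
  by rewrite -hn turan2_base // H.
have hs := sum_wsumD1 A; rewrite cA in hs.
have : \sum_(x in A) wsum u (A :\ x) <= \sum_(x in A) turan2 r n.
  apply: ler_sum => x xA.
  have cx : #|A :\ x| = n by move: cA; rewrite (cardsD1 x) xA => -[].
  by rewrite -[in turan2 r n]cx; apply: IH => //; rewrite cx -ltnS -cA.
rewrite sumr_const cA hs -mulr_natl => h.
rewrite cA in hn *.
have h2 := @turan2_average r n ltac:(lia) r0.
have [k1 hk1] := wsum_even A; have [k2 hk2] := turan2_even n.+1 r0.
rewrite hk1 hk2 in h h2 *.
have : (n%:Z - 1) * k1 < (n%:Z - 1) * (k2 + 1) by lia.
have n1 : 0 < n%:Z - 1 by lia.
by rewrite ltr_pM2l // => ?; lia.
Qed.

Lemma wsum_le_le1 A : (forall x y, x \in A -> y \in A -> x != y -> u x y <= 1) ->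
  wsum u A <= #|A|%:Z * (#|A|%:Z - 1).
Proof.
move=> h; apply: (@le_trans _ _ (\sum_(x in A) (#|A|%:Z - 1))); last first.
  by rewrite sumr_const -mulr_natl natz.
apply: ler_sum => x xA; rewrite (deg_inD1 _ xA) u_diag add0r.
apply: (@le_trans _ _ (\sum_(y in A :\ x) 1)).
  by apply: ler_sum => y; rewrite !inE => /andP[yx yA]; rewrite h // eq_sym.
by rewrite sumr_const (cardsD1 x A) xA; lia.
Qed.

(** If all vertices of [A] have large degree in [A], some vertex of [A] outside
    of [Q] sends a large weight to [Q]. *)
Lemma extend_set (A Q : {set V}) (d l B : int) : Q \subset A ->
  (forall x, x \in A -> d <= deg_in u x A) ->
  (forall x y, u x y <= B) -> 0 <= B -> 0 <= l ->
  l * #|A|%:Z + #|Q|%:Z * #|Q|%:Z * B < #|Q|%:Z * d ->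
  exists2 x, x \in A :\: Q & l < deg_in u x Q.
Proof.
move=> QA hd hB B0 l0 H; apply: contrapT => hn.
have {}hn x : x \in A :\: Q -> deg_in u x Q <= l.
  by move=> hx; rewrite leNgt; apply/negP => ?; apply: hn; exists x.
have h1 : #|Q|%:Z * d <= \sum_(v in Q) deg_in u v A.
  rewrite -natz mulr_natl -sumr_const; apply: ler_sum => v vQ.
  by apply: hd; apply: (fintype.subsetP QA).
have h2 : \sum_(v in Q) deg_in u v A = \sum_(x in A) deg_in u x Q.
  rewrite /deg_in exchange_big /=.
  by apply: eq_bigr => x _; apply: eq_bigr => y _; apply: u_sym.
have h3 : \sum_(x in A) deg_in u x Q <= l * #|A|%:Z + #|Q|%:Z * #|Q|%:Z * B.
  rewrite (big_setID Q) /= (finset.setIidPr QA) addrC; apply: lerD.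
    apply: (@le_trans _ _ (\sum_(x in A :\: Q) l)); first exact: ler_sum.
    rewrite sumr_const -mulr_natr natz ler_wpM2l //.
    by have := subset_leq_card (finset.subsetDl A Q); lia.
  rewrite -mulrA -{1}natz mulr_natl -sumr_const; apply: ler_sum => x _.
  rewrite -natz mulr_natl -sumr_const; exact: ler_sum.
lia.
Qed.

(** A large minimum degree forbids dense sets of [r + 1] vertices: such a set
    could be enlarged to [r + t] vertices, losing at most one unit of weight per
    new vertex. *)
Lemma no_dense_set (r t : nat) (A Q : {set V}) (d B : int) :
  (0 < t <= r)%N ->
  (forall X : {set V}, #|X| = (r + t)%N ->
     wsum u X <= (r + t)%N%:Z * ((r + t)%N%:Z - 1) - t%:Z *+ 2) ->
  (forall x, x \in A -> d <= deg_in u x A) ->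
  (forall x y, u x y <= B) -> 0 <= B ->
  (forall K : nat, (r < K < r + t)%N ->
     (K%:Z - 2) * #|A|%:Z + K%:Z * K%:Z * B < K%:Z * d) ->
  Q \subset A -> #|Q| = r.+1 -> wsum u Q < r.+1%:Z * r%:Z.
Proof.
move=> /andP[t0 tr] H hd hB B0 hK QA cQ; rewrite ltNge; apply/negP => hQ.
have step (k : nat) : (0 < k <= t)%N -> exists X : {set V},
    [/\ X \subset A, #|X| = (r + k)%N &
    (r + k)%N%:Z * ((r + k)%N%:Z - 1) - (k%:Z - 1) *+ 2 <= wsum u X].
  elim: k => [//|[_ _|k IH kt]].
    by exists Q; split; rewrite // ?addn1 //; lia.
  have [|X [XA cX hX]] := IH; first lia.
  have := @extend_set A X d ((r + k.+1)%N%:Z - 2) B XA hd hB B0.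
  rewrite cX => /(_ ltac:(lia)) [|x]; first by apply: hK; lia.
  rewrite inE => /andP[xX xA] hx; exists (x |: X); split.
  - by rewrite finset.subUset finset.sub1set xA.
  - by rewrite cardsU1 xX cX; lia.
  - by rewrite wsumU1 //; lia.
have [|X [_ cX hX]] := step t; first lia.
by have := H X cX; lia.
Qed.

End Weights.

(** * Balanced colourings and the uniqueness of the Turan graph *)

(** The vertices of [A] of colour [i]. *)
Definition color_class (V T : finType) (c : V -> T) (A : {set V}) (i : T) : {set V} :=
  [set x in A | c x == i]%SET.

Lemma in_color_class (V T : finType) (c : V -> T) (A : {set V}) i x :
  (x \in color_class c A i) = (x \in A) && (c x == i).
Proof. by rewrite inE. Qed.

(** A colouring of [A] whose classes, possibly empty, differ in size by at most
    one. *)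
Definition balanced (V T : finType) (c : V -> T) (A : {set V}) : Prop :=
  forall i j : T, (#|color_class c A i| <= #|color_class c A j| + 1)%N.

Section Balanced.
Variables (V T : finType) (c : V -> T).
Implicit Types (A : {set V}).

Lemma sum_card_class A : (\sum_(i : T) #|color_class c A i| = #|A|)%N.
Proof.
rewrite -[in RHS]sum1_card (partition_big c xpredT) //=.
by apply: eq_bigr => i _; rewrite -sum1_card; apply: eq_bigl => x; rewrite !inE.
Qed.

Lemma balanced_card A i : balanced c A ->
  (#|A| %/ #|T| <= #|color_class c A i| <= (#|A| %/ #|T|).+1)%N.
Proof.
move=> bal; have T0 : (0 < #|T|)%N by apply/card_gt0P; exists i.
have hs := sum_card_class A; rewrite (bigD1 i) //= in hs.
have cT : (\sum_(j | j != i) 1 = #|T|.-1)%N.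
  have : (\sum_(j : T) 1 = #|T|)%N by rewrite sum1_card.
  by rewrite (bigD1 i) //=; lia.
have h1 : (\sum_(j | j != i) #|color_class c A j| <=
    (#|color_class c A i|).+1 * #|T|.-1)%N.
  by rewrite -cT big_distrr /=; apply: leq_sum => j _; have := bal j i; lia.
have h2 : ((#|color_class c A i|).-1 * #|T|.-1 <=
    \sum_(j | j != i) #|color_class c A j|)%N.
  by rewrite -cT big_distrr /=; apply: leq_sum => j _; have := bal i j; lia.
have hm := divn_eq #|A| #|T|; have hj := ltn_pmod #|A| T0.
have e : (#|T| = #|T|.-1.+1)%N by lia.
rewrite leqNgt; apply/andP; split; first apply/negP => hlt.
  set p := (_ %/ _)%N in hm hlt *; set k := #|color_class _ _ _| in hs h1 h2 hlt *.
  have : (k.+1 * #|T|.-1 <= p * #|T|.-1)%N by rewrite leq_mul2r hlt orbT.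
  have : (p * #|T| = p * #|T|.-1 + p)%N by rewrite {1}e mulnS addnC.
  lia.
rewrite leqNgt; apply/negP => hlt.
set p := (_ %/ _)%N in hm hlt *; set k := #|color_class _ _ _| in hs h1 h2 hlt *.
have : (p.+1 * #|T|.-1 <= k.-1 * #|T|.-1)%N by rewrite leq_mul2r; apply/orP; right; lia.
have : (p * #|T| = p * #|T|.-1 + p)%N by rewrite {1}e mulnS addnC.
lia.
Qed.

Lemma deg_in_color A x :
  deg_in (fun x y => (c x != c y)%:Z) x A = #|A|%:Z - #|color_class c A (c x)|%:Z.
Proof.
have -> : deg_in (fun x y => (c x != c y)%:Z) x A =
    \sum_(y in A) (1 - (c y == c x)%:Z).
  by apply: eq_bigr => y _; rewrite eq_sym; case: eqP.
rewrite big_split /= sumr_const sumrN natz; congr (_ - _).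
transitivity (\sum_(y in color_class c A (c x)) (1 : int)); last first.
  by rewrite sumr_const natz.
rewrite [RHS](eq_bigl (fun y => (y \in A) && (c y == c x))); last by move=> y; rewrite !inE.
by rewrite big_mkcondr; apply: eq_bigr => y _; case: eqP.
Qed.

Lemma wsum_color_classes A :
  wsum (fun x y => (c x != c y)%:Z) A = #|A|%:Z * #|A|%:Z -
    \sum_(i : T) #|color_class c A i|%:Z * #|color_class c A i|%:Z.
Proof.
rewrite /wsum; under eq_bigr do rewrite deg_in_color.
rewrite big_split /= sumr_const sumrN -[_ *+ #|A|]mulr_natl natz; congr (_ - _).
rewrite (partition_big c xpredT) //=; apply: eq_bigr => i _.
rewrite -{1}[#|color_class c A i|%:Z]natz mulr_natl -sumr_const.
by apply: eq_big => [x|x /andP[_ /eqP ->]] //; rewrite !inE.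
Qed.

Lemma sumz_card_class A : \sum_(i : T) #|color_class c A i|%:Z = #|A|%:Z.
Proof.
rewrite -[in RHS](sum_card_class A) -!natz natr_sum.
by apply: eq_bigr => i _; rewrite natz.
Qed.

(** A complete multipartite graph misses at least [t] pairs inside every set with
    [t] more vertices than there are parts: a part meeting the set in [k] vertices
    contains at least [k - 1] of its pairs. *)
Lemma wsum_color_le t A : #|A| = (#|T| + t)%N ->
  wsum (fun x y => (c x != c y)%:Z) A <= #|A|%:Z * (#|A|%:Z - 1) - t%:Z *+ 2.
Proof.
move=> cA; rewrite wsum_color_classes.
have : \sum_(i : T) (3 * #|color_class c A i|%:Z - 2) <=
  \sum_(i : T) #|color_class c A i|%:Z * #|color_class c A i|%:Z.
  apply: ler_sum => i _; set k := #|_|.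
  by case: k => [|[|k]] //; nia.
rewrite big_split /= -big_distrr /= sumz_card_class sumr_const -[_ *+ #|_|]mulr_natr natz => h.
rewrite -/(#|T|) in h; lia.
Qed.

Lemma wsum_color A : (0 < #|T|)%N -> balanced c A ->
  wsum (fun x y => (c x != c y)%:Z) A = turan2 #|T| #|A|.
Proof.
move=> T0 bal; rewrite wsum_color_classes.
set p := (#|A| %/ #|T|)%N.
have -> : \sum_(i : T) #|color_class c A i|%:Z * #|color_class c A i|%:Z =
   \sum_(i : T) ((p%:Z *+ 2 + 1) * #|color_class c A i|%:Z - p%:Z * (p%:Z + 1)).
  apply: eq_bigr => i _; have := balanced_card i bal; rewrite -/p.
  case: (eqVneq #|color_class c A i| p) => [-> _|ne h]; first lia.
  have -> : #|color_class c A i| = p.+1 by lia.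
  lia.
rewrite big_split /= -big_distrr /= sumz_card_class sumr_const.
rewrite /turan2 -/p -[_ *+ #|_|]mulr_natl !natz.
have hm := divn_eq #|A| #|T|; rewrite -/p in hm.
set j := (#|A| %% #|T|)%N in hm *.
have -> : #|A|%:Z = p%:Z * #|T|%:Z + j%:Z by lia.
rewrite -/(#|T|); set tt := #|T|%:Z; ring.
Qed.

End Balanced.

Section TuranUnique.
Variables (V : finType) (u : V -> V -> int) (r : nat).
Hypothesis u_sym : forall x y, u x y = u y x.
Hypothesis u_diag : forall x, u x x = 0.
Hypothesis u01 : forall x y, u x y = 0 \/ u x y = 1.
Hypothesis r0 : (0 < r)%N.
Hypothesis no_clique : forall Q : {set V}, #|Q| = r.+1 -> wsum u Q < r.+1%:Z * r%:Z.

(** The case [t = 1] of the bound on sums, which also holds for small sets here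
    because the weights are at most one. *)
Lemma clique_free_le (A : {set V}) : wsum u A <= turan2 r #|A|.
Proof.
have [h|h] := leqP #|A| r.
  rewrite turan2_small //; apply: wsum_le_le1 => // x y _ _ _.
  by case: (u01 x y) => ->.
apply: (@wsum_le_turan2 _ u u_sym u_diag r 1) => //; last by rewrite addn1.
move=> X cX; have := no_clique (_ : #|X| = r.+1).
rewrite cX addn1 => /(_ erefl) h'.
have [k hk] := wsum_even u_sym u_diag X.
have : exists k : int, r.+1%:Z * r%:Z = k *+ 2.
  have [k' hk'] := turan2_even r.+1 r0.
  exists (k' + 1); move: hk'; rewrite turan2S // turan2_small // divnn r0; lia.
case=> k' hk'; lia.
Qed.

(** A vertex with neighbours in all the colour classes of a complete
    [r]-partite graph completes a clique on [r + 1] vertices. *)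
Lemma missed_color (A : {set V}) (c : V -> 'I_r) x : x \notin A ->
  {in A &, forall y z, u y z = (c y != c z)%:Z} ->
  exists i, forall y, y \in A -> c y = i -> u x y = 0.
Proof.
move=> xA hc; apply: contrapT => hn.
have hn' i : {y | (y \in A) && ((c y == i) && (u x y == 1))}.
  apply/sigW; apply: contrapT => hi; apply: hn; exists i => y yA cy.
  case: (u01 x y) => // h1; exfalso; apply: hi; exists y.
  by rewrite yA cy h1 !eqxx.
pose g i := sval (hn' i).
have gA i : g i \in A by rewrite /g; case: (hn' i) => y /= /andP[].
have cg i : c (g i) = i by rewrite /g; case: (hn' i) => y /= /and3P[_ /eqP].
have ug i : u x (g i) = 1 by rewrite /g; case: (hn' i) => y /= /and3P[_ _ /eqP].
have g_inj : injective g by move=> i j h; rewrite -(cg i) h cg.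
pose Q := [set g i | i : 'I_r]%SET.
have cQ : #|Q| = r by rewrite card_imset // card_ord.
have xQ : x \notin Q.
  by apply/imsetP => -[i _ xi]; move: xA; rewrite xi gA.
have := no_clique (_ : #|x |: Q| = r.+1); rewrite cardsU1 xQ cQ => /(_ erefl).
rewrite wsumU1 //.
have -> : deg_in u x Q = r%:Z.
  rewrite /deg_in big_imset /=; last by move=> i j _ _; apply: g_inj.
  by under eq_bigr do rewrite ug; rewrite sumr_const card_ord natz.
suff -> : wsum u Q = r%:Z * (r%:Z - 1) by lia.
have -> : wsum u Q = \sum_(y in Q) (r%:Z - 1).
  apply: eq_bigr => y yQ; rewrite (deg_inD1 _ _ yQ) u_diag add0r.
  transitivity (\sum_(z in Q :\ y) (1 : int)).
    apply: eq_bigr => z; rewrite inE => /andP[zy zQ].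
    move/imsetP: yQ zy => [i _ ->]; move/imsetP: zQ => [j _ ->] zy.
    by rewrite hc // !cg; move: zy; rewrite inE; case: (eqVneq i j) => // ->; rewrite eqxx.
  by rewrite sumr_const natz -cQ (cardsD1 y Q) yQ; lia.
by rewrite sumr_const cQ -mulr_natl natz.
Qed.

(** Turan's theorem, case of equality. *)
Lemma turan_unique (A : {set V}) : wsum u A = turan2 r #|A| ->
  exists2 c : V -> 'I_r, balanced c A &
    {in A &, forall x y, u x y = (c x != c y)%:Z}.
Proof.
move: {2}(#|A|) (erefl #|A|) => n; elim: n A => [|n IH] A cA hA.
  exists (fun=> Ordinal r0); rewrite (cards0_eq cA).
    by move=> i j; rewrite (_ : color_class _ _ i = finset.set0) ?cards0 //;
       apply/setP => x; rewrite !inE.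
  by move=> x y; rewrite inE.
have [x xA dx] : exists2 x, x \in A & deg_in u x A <= n%:Z - (n %/ r)%N%:Z.
  apply: contrapT => hn.
  have : \sum_(x in A) (n%:Z - (n %/ r)%N%:Z + 1) <= wsum u A.
    apply: ler_sum => x xA; rewrite leNgt; apply/negP => h; apply: hn.
    by exists x => //; lia.
  have := turan2_average_deg n r0.
  by rewrite hA cA sumr_const cA -mulr_natl natz; lia.
have cAx : #|A :\ x| = n by move: cA; rewrite (cardsD1 x) xA => -[].
have hx := wsumD1 u_sym u_diag xA; rewrite hA cA turan2S // in hx.
have hAx := clique_free_le (A :\ x); rewrite cAx in hAx.
have eAx : wsum u (A :\ x) = turan2 r #|A :\ x| by rewrite cAx; lia.
have edx : deg_in u x A = n%:Z - (n %/ r)%N%:Z by lia.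
have [c bal hc] := IH _ cAx eAx.
have xAx : x \notin A :\ x by rewrite !inE eqxx.
have [i hi] := missed_color xAx hc.
(* The degree of [x] forces the missed class to be of minimum size, and [x] to
   be joined to everything else. *)
have bc j := balanced_card j bal; rewrite cAx card_ord in bc.
pose C := color_class c (A :\ x) i.
have dC : deg_in u x A = \sum_(y in (A :\ x) :\: C) u x y.
  rewrite (deg_inD1 _ _ xA) u_diag add0r /deg_in (big_setID C) /= big1 ?add0r //.
  by move=> y; rewrite !inE => /andP[/andP[yx yA] /andP[_ /eqP cy]]; apply: hi; rewrite // !inE yx.
have CA : C \subset A :\ x by apply/fintype.subsetP => y; rewrite !inE => /andP[].
have cC : #|(A :\ x) :\: C| = (n - #|C|)%N by rewrite cardsD (finset.setIidPr CA) cAx.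
have u1 y : u x y <= 1 by case: (u01 x y) => ->.
have le1 : \sum_(y in (A :\ x) :\: C) u x y <= \sum_(y in (A :\ x) :\: C) 1.
  exact: ler_sum.
have Cn : (#|C| <= n)%N by rewrite -cAx subset_leq_card.
rewrite sumr_const cC -dC edx natz in le1.
have eC : #|C| = (n %/ r)%N by have := bc i; rewrite -/C; lia.
have all1 y : y \in (A :\ x) :\: C -> u x y = 1.
  move=> hy; case: (u01 x y) => // h; exfalso.
  have : \sum_(y in (A :\ x) :\: C) u x y <= \sum_(z in ((A :\ x) :\: C) :\ y) 1.
    by rewrite (big_setD1 y hy) /= h add0r; apply: ler_sum.
  by rewrite -dC sumr_const natz edx; move: cC; rewrite (cardsD1 y) hy; lia.
pose c' y := if y == x then i else c y.
have hC' j : #|color_class c' A j| = ((i == j) + #|color_class c (A :\ x) j|)%N.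
  rewrite (cardsD1 x) !inE xA /c' eqxx; congr (_ + _)%N.
  by apply: eq_card => y; rewrite !inE; case: (eqVneq y x).
exists c'.
  move=> j k; rewrite !hC'; have := bc j; have := bc k; have := bc i.
  by rewrite -/C eC; case: (eqVneq i j) => [<-|?]; case: (eqVneq i k) => [<-|?]; rewrite -/C ?eC; lia.
have key y : y \in A -> y != x -> u x y = (i != c y)%:Z.
  move=> yA yx; have [e|ne] := eqVneq i (c y).
    by apply: hi; rewrite ?inE ?yx.
  by apply: all1; rewrite !inE yx yA eq_sym (negbTE ne).
move=> y z yA zA; rewrite /c'.
have [->|yx] := eqVneq y x; have [->|zx] := eqVneq z x; rewrite ?eqxx //.
- exact: key.
- by rewrite u_sym key // eq_sym.
- by apply: hc; rewrite !inE ?yx ?zx.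
Qed.

End TuranUnique.

(** * Multigraphs and Turan multigraphs *)

Lemma bin2_mul2 n : ('C(n, 2) * 2)%N = (n * n.-1)%N.
Proof. by rewrite mulnC -mul_bin_diag bin1. Qed.

Lemma wsum_pair_fun (V : finType) (f : edge V -> int) (X : {set V}) :
  wsum (pair_fun f) X = (\sum_(e : edge V | val e \subset X) f e) *+ 2.
Proof. exact: sum_pair_fun. Qed.

Lemma wsum_pair_funT (V : finType) (f : edge V -> int) :
  wsum (pair_fun f) [set: V]%SET = (\sum_(e : edge V) f e) *+ 2.
Proof.
rewrite wsum_pair_fun; congr (_ *+ _).
by apply: eq_bigl => e; rewrite finset.subsetT.
Qed.

Lemma card_edge_in (V : finType) (X : {set V}) :
  (#|[pred e : edge V | val e \subset X]|%:Z *+ 2 = #|X|%:Z * (#|X|%:Z - 1)).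
Proof.
have := sum_pair_fun (fun _ : edge V => 1 : int) X.
rewrite sumr_const natz => <-.
rewrite [in RHS]mulrC -[X in _ = _ * X]natz mulr_natr -sumr_const.
apply: eq_bigr => x xX; rewrite (big_setD1 x xX) /= pair_fun_diag add0r.
transitivity (\sum_(y in X :\ x) (1 : int)).
  apply: eq_bigr => y; rewrite !inE => /andP[yx _].
  by have [e _ ->] := pair_funP (fun _ : edge V => 1 : int) (negbT (introF eqP (fun h => negP yx (introT eqP (esym h))))).
by rewrite sumr_const natz (cardsD1 x X) xX; lia.
Qed.

(** The weight of an edge relative to the base weight [a - 1]. *)
Definition excess (V : finType) (a : nat) (G : multigraph V) (e : edge V) : int :=
  (G e)%:Z - (a%:Z - 1).

Lemma sq_graph_wsum (V : finType) (s q a t : nat) (G : multigraph V) :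
  (q + t = a * 'C(s, 2))%N ->
  sq_graph s q G <-> (forall X : {set V}, #|X| = s ->
    wsum (pair_fun (excess a G)) X <= s%:Z * (s%:Z - 1) - t%:Z *+ 2).
Proof.
move=> qE; have hb := bin2_mul2 s.
have key (X : {set V}) : #|X| = s ->
  wsum (pair_fun (excess a G)) X =
  (\sum_(e : edge V | val e \subset X) G e)%N%:Z *+ 2 - (a%:Z - 1) * (s%:Z * (s%:Z - 1)).
  move=> cX; rewrite wsum_pair_fun /excess big_split sumrN sumr_const.
  have := card_edge_in X; rewrite cX => <-.
  rewrite -[_ *+ #|_|]mulr_natl natz.
  have -> : \sum_(e : edge V | val e \subset X) (G e)%:Z =
    (\sum_(e : edge V | val e \subset X) G e)%N%:Z.
    by rewrite -[RHS]natz natr_sum; apply: eq_bigr => e _; rewrite natz.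
  rewrite -/(#|[pred e : edge V | val e \subset X]|); set S1 := (\sum_(_ | _) _)%N; set S := #|_| => /=; lia.
have hs : s%:Z * (s%:Z - 1) = ('C(s, 2))%:Z *+ 2 by case: s hb {qE key} => [|s'] /=; lia.
have hq : q%:Z + t%:Z = a%:Z * ('C(s, 2))%:Z by lia.
split=> H X cX.
  have := H X cX; rewrite key // hs; set S := (\sum_(_ | _) _)%N; nia.
have := H X cX; rewrite key // hs; set S := (\sum_(_ | _) _)%N; nia.
Qed.

Section ColorGraph.
Variables (V T : finType) (c : V -> T) (a : nat).

(** The edges whose ends have different colours. *)
Definition bichromatic (e : edge V) : bool :=
  [exists x in val e, [exists y in val e, c x != c y]].

(** The multigraph with the weight [a - 1] inside the colour classes and [a] between
    them. *)
Definition color_graph : multigraph V := [ffun e => (a - 1 + bichromatic e)%N].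

Lemma bichromatic_pair e x y : val e = [set x; y]%SET -> bichromatic e = (c x != c y).
Proof.
rewrite /bichromatic => ->; apply/exists_inP/idP.
  case=> x' hx /exists_inP[y' hy]; move: hx hy; rewrite !inE.
  by move=> /orP[]/eqP-> /orP[]/eqP->; rewrite ?eqxx // eq_sym.
move=> h; exists x; first by rewrite !inE eqxx.
by apply/exists_inP; exists y; rewrite // !inE eqxx orbT.
Qed.

Lemma pair_fun_bichromatic x y :
  pair_fun (fun e => (bichromatic e)%:Z) x y = (c x != c y)%:Z.
Proof.
have [->|xy] := eqVneq x y; first by rewrite pair_fun_diag eqxx.
by have [e he ->] := pair_funP (fun e => (bichromatic e)%:Z) xy; rewrite (bichromatic_pair he).
Qed.

Lemma excess_color_graph e : (0 < a)%N -> excess a color_graph e = (bichromatic e)%:Z.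
Proof. by rewrite /excess ffunE; lia. Qed.

Lemma wsum_color_graph A : (0 < a)%N -> wsum (pair_fun (excess a color_graph)) A =
  wsum (fun x y => (c x != c y)%:Z) A.
Proof.
move=> a0; apply: eq_bigr => x _; apply: eq_bigr => y _.
rewrite -pair_fun_bichromatic /pair_fun; case: insub => //= e.
exact: excess_color_graph.
Qed.

Lemma color_graph_sq s q t : (0 < a)%N -> (q + t = a * 'C(s, 2))%N ->
  s = (#|T| + t)%N -> sq_graph s q color_graph.
Proof.
move=> a0 qE sE; apply/(sq_graph_wsum _ qE) => X cX.
by rewrite wsum_color_graph // -cX; apply: wsum_color_le; rewrite cX.
Qed.

Lemma edge_prod_color_graph : (0 < a)%N -> edge_prod color_graph =
  ((a - 1) ^ ('C(#|V|, 2) - #|bichromatic|) * a ^ #|bichromatic|)%N.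
Proof.
move=> a0; rewrite /edge_prod (bigID bichromatic) /= mulnC; congr (_ * _)%N.
  rewrite -card_edge -(cardC bichromatic) addKn -prod_nat_const.
  apply: eq_big => [e|e /negbTE h]; first by rewrite !inE.
  by rewrite ffunE h addn0.
rewrite -prod_nat_const; apply: eq_big => // e h.
by rewrite ffunE h subnK.
Qed.

Lemma card_bichromatic : (0 < #|T|)%N -> balanced c [set: V]%SET ->
  #|bichromatic|%:Z *+ 2 = turan2 #|T| #|V|.
Proof.
move=> T0 bal; rewrite -[#|V|]cardsT -(wsum_color T0 bal).
transitivity (wsum (pair_fun (fun e => (bichromatic e)%:Z)) [set: V]%SET).
  rewrite wsum_pair_funT; congr (_ *+ _).
  rewrite -natz -sumr_const big_mkcond /=; apply: eq_bigr => e _.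
  by rewrite -topredE /=; case: bichromatic.
by apply: eq_bigr => x _; apply: eq_bigr => y _; apply: pair_fun_bichromatic.
Qed.

End ColorGraph.

Section Preim.
Variables (V T : finType) (c : V -> T).
Let P := preim_partition c [set: V]%SET.

Lemma mem_preim_partition (U : {set V}) :
  reflect (exists x, U = color_class c [set: V]%SET (c x)) (U \in P).
Proof.
have e x : [set y in [set: V]%SET | c x == c y]%SET = color_class c [set: V]%SET (c x).
  by apply/setP => y; rewrite !inE eq_sym.
apply: (iffP imsetP) => [[x _ ->]|[x ->]]; exists x; rewrite ?inE ?e //.
Qed.

Lemma crossing_preim (e : edge V) : crossing P e = bichromatic c e.
Proof.
have [[x y] xy he] := edge_witness e; rewrite [(x, y).1]/= [(x, y).2]/= in xy he.
rewrite (bichromatic_pair c he) /crossing he.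
apply/exists_inP/idP => [[U /mem_preim_partition[x' ->]]|cxy].
  case/exists_inP => W /mem_preim_partition[y' ->] /and3P[ne hU hW].
  apply: contraNneq ne => cxy; apply/eqP; congr color_class.
  move: hU hW; rewrite -!finset.setI_eq0 => /set0Pn[z hz] /set0Pn[w hw].
  move: hz hw; rewrite !inE => /andP[hz /eqP <-] /andP[hw /eqP <-].
  by move: hz hw => /orP[]/eqP-> /orP[]/eqP->.
exists (color_class c [set: V]%SET (c x)); first by apply/mem_preim_partition; exists x.
apply/exists_inP; exists (color_class c [set: V]%SET (c y)).
  by apply/mem_preim_partition; exists y.
rewrite -!finset.setI_eq0; apply/and3P; split.
- by apply: contra cxy => /eqP/setP/(_ x); rewrite !inE eqxx => /esym.
- by apply/set0Pn; exists x; rewrite !inE !eqxx.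
- by apply/set0Pn; exists y; rewrite !inE !eqxx orbT.
Qed.

Lemma equipartition_preim : balanced c [set: V]%SET -> (0 < #|T| <= #|V|)%N ->
  equipartition #|T| P.
Proof.
move=> bal /andP[T0 TV].
have ne i : exists x, c x = i.
  have := balanced_card i bal; rewrite cardsT => /andP[h _].
  have : (0 < #|color_class c [set: V]%SET i|)%N by apply: leq_trans h; rewrite divn_gt0.
  by case/card_gt0P => x; rewrite !inE => /eqP cx; exists x.
have PE : P = [set color_class c [set: V]%SET i | i : T]%SET.
  apply/setP => U; apply/mem_preim_partition/imsetP => [[x ->]|[i _ ->]].
    by exists (c x).
  by have [x <-] := ne i; exists x.
split; first exact: preim_partitionP.
  rewrite PE card_imset // => i j /setP h; have [x cx] := ne i.
  by have := h x; rewrite !inE cx eqxx => /esym/eqP.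
by move=> U W /mem_preim_partition[x ->] /mem_preim_partition[y ->]; apply: bal.
Qed.

End Preim.

(** Turan multigraphs are given by balanced colourings; no class is empty since
    [r <= n]. *)
Lemma turan_multigraphsP (r a n : nat) (G : multigraph 'I_n) :
  (0 < a)%N -> (0 < r <= n)%N ->
  turan_multigraphs r a n G <->
  exists2 c : 'I_n -> 'I_r, balanced c [set: 'I_n]%SET & G = color_graph c a.
Proof.
move=> a0 /andP[r0 rn]; split.
  case=> P [[partP cP balP] inG crossG]; subst r.
  have [/eqP covP triv _] := and3P partP.
  have xP x : finset.pblock P x \in P by apply: finset.pblock_mem; rewrite covP inE.
  pose c x := enum_rank_in (xP x) (finset.pblock P x).
  have cK x : enum_val (c x) = finset.pblock P x by rewrite /c enum_rankK_in.
  have mem_block x U : U \in P -> (x \in U) = (finset.pblock P x == U).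
    move=> UP; apply/idP/eqP => [xU|<-]; first exact: finset.def_pblock.
    by rewrite finset.mem_pblock covP inE.
  have classE i : color_class c [set: 'I_n]%SET i = enum_val i.
    apply/setP => x; rewrite !inE /= mem_block ?enum_valP // -cK.
    by apply/eqP/eqP => [->//|]; apply: enum_val_inj.
  exists c; first by move=> i j; rewrite !classE; apply: balP; apply: enum_valP.
  apply/ffunP => e; rewrite ffunE.
  have [[x y] xy he] := edge_witness e; rewrite [(x, y).1]/= [(x, y).2]/= in xy he.
  rewrite (bichromatic_pair c he); case: (eqVneq (c x) (c y)) => cxy.
    rewrite addn0; apply: (inG (finset.pblock P x)) => //.
    by rewrite he finset.subUset !finset.sub1set !mem_block // eqxx -!cK cxy eqxx.
  rewrite subnK // crossG //; apply/exists_inP; exists (finset.pblock P x) => //.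
  apply/exists_inP; exists (finset.pblock P y) => //; apply/and3P; split.
  - by rewrite -!cK (inj_eq enum_val_inj).
  - by rewrite -finset.setI_eq0; apply/set0Pn; exists x; rewrite !inE he !inE eqxx mem_block // eqxx.
  - by rewrite -finset.setI_eq0; apply/set0Pn; exists y; rewrite !inE he !inE eqxx orbT mem_block // eqxx.
case=> c bal ->; exists (preim_partition c [set: 'I_n]%SET); split.
- by have := equipartition_preim bal; rewrite !card_ord r0 rn => /(_ isT).
- move=> U e /mem_preim_partition[x ->] eU; rewrite ffunE.
  have [[y z] yz he] := edge_witness e; rewrite [(y, z).1]/= [(y, z).2]/= in yz he.
  move: eU; rewrite (bichromatic_pair c he) he finset.subUset !finset.sub1set !inE /=.
  by move=> /andP[/eqP-> /eqP->]; rewrite eqxx addn0.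
- by move=> e; rewrite crossing_preim ffunE => ->; rewrite subnK.
Qed.

(** The colouring by residues modulo [r]. *)
Definition mod_color (r n : nat) (r0 : (0 < r)%N) (x : 'I_n) : 'I_r :=
  Ordinal (ltn_pmod x r0).

Lemma count_mod r n i : (i < r)%N ->
  (\sum_(x < n) (x %% r == i) = n %/ r + (i < n %% r))%N.
Proof.
move=> ir; elim: n => [|n IH]; first by rewrite big_ord0 div0n mod0n.
rewrite big_ord_recr /= IH.
have hm := divn_eq n r; have hj := ltn_pmod n (leq_ltn_trans (leq0n i) ir).
set p := (n %/ r)%N in hm *; set j := (n %% r)%N in hm hj *.
have [jr|jr] := ltnP j.+1 r.
  have hm' : n.+1 = (p * r + j.+1)%N by lia.
  have -> : (n.+1 %/ r = p)%N by rewrite hm' divnMDl ?divn_small ?addn0 //; lia.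
  have -> : (n.+1 %% r = j.+1)%N by rewrite hm' modnMDl modn_small.
  lia.
have ej : j = r.-1 by lia.
have hm' : n.+1 = (p.+1 * r)%N by lia.
have -> : (n.+1 %/ r = p.+1)%N by rewrite hm' mulnK //; lia.
have -> : (n.+1 %% r = 0)%N by rewrite hm' modnMl.
lia.
Qed.

Lemma balanced_mod r n (r0 : (0 < r)%N) :
  balanced (@mod_color r n r0) [set: 'I_n]%SET.
Proof.
have h i : #|color_class (@mod_color r n r0) [set: 'I_n]%SET i| =
    (n %/ r + (i < n %% r))%N.
  rewrite -(count_mod n (ltn_ord i)) -sum1_card big_mkcond /=.
  by apply: eq_bigr => x _; rewrite !inE -val_eqE /=; case: eqP.
by move=> i j; rewrite !h; case: (i < _)%N; case: (j < _)%N; lia.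
Qed.

Lemma turan_edgesE r n (r0 : (0 < r)%N) :
  turan_edges r n = #|bichromatic (@mod_color r n r0)|.
Proof. by apply: eq_card => e; exact: (crossing_preim (mod_color r0) e). Qed.

Lemma turan_edges2 r n : (0 < r)%N -> (turan_edges r n)%:Z *+ 2 = turan2 r n.
Proof.
move=> r0; rewrite (turan_edgesE n r0) card_bichromatic ?card_ord //.
exact: balanced_mod.
Qed.

(** All Turan multigraphs have the same product. *)
Lemma edge_prod_turan (r a n : nat) (c : 'I_n -> 'I_r) : (0 < a)%N -> (0 < r)%N ->
  balanced c [set: 'I_n]%SET ->
  edge_prod (color_graph c a) =
  ((a - 1) ^ ('C(n, 2) - turan_edges r n) * a ^ turan_edges r n)%N.
Proof.
move=> a0 r0 bal; rewrite edge_prod_color_graph // card_ord.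
have := turan_edges2 n r0; have := card_bichromatic _ bal.
rewrite !card_ord => /(_ r0) <- h.
by have -> : turan_edges r n = #|bichromatic c| by lia.
Qed.

Lemma turan_edges_le r n : (0 < r)%N -> (turan_edges r n <= 'C(n, 2))%N.
Proof.
by move=> r0; rewrite (turan_edgesE n r0) -[n in 'C(n, 2)]card_ord -card_edge max_card.
Qed.

(** * The product against the sum *)

Section LogWeight.
Variables (R : realType) (a : nat).
Hypothesis a2 : (2 <= a)%N.

(** The ratio [a / (a - 1)], and the loss factor of a weight other than [a - 1]
    and [a]. *)
Definition wratio : R := a%:R / (a%:R - 1).
Definition wloss : R := 1 - a%:R ^- 2.

Let b : R := a%:R - 1.

Lemma base_ge1 : 1 <= b.
Proof. by rewrite /b lerBrDr -mulr2n ler_nat. Qed.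

Let b_gt0 : 0 < b. Proof. exact: lt_le_trans base_ge1. Qed.
Let aE : a%:R = b + 1 :> R. Proof. by rewrite /b subrK. Qed.

Lemma wratio_gt1 : 1 < wratio.
Proof. by rewrite /wratio -/b ltr_pdivlMr // mul1r aE ltrDl. Qed.

Let ratioE : wratio = (b + 1) / b. Proof. by rewrite /wratio aE addrK. Qed.

Let lossE : wloss = b * (b + 2) / ((b + 1) * (b + 1)).
Proof. by rewrite /wloss aE; field; rewrite lt0r_neq0 // addr_gt0. Qed.

Lemma wloss_bounds : 0 < wloss < 1.
Proof.
have b0 := b_gt0; have b1 : 0 < b + 1 by lra.
have b2 : 0 < (b + 1) * (b + 1) by rewrite mulr_gt0.
rewrite lossE; apply/andP; split; first by rewrite divr_gt0 // mulr_gt0 //; lra.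
by rewrite ltr_pdivrMr // mul1r; nra.
Qed.

(** By convexity [b + k <= b * ratio ^ k], with equality for [k = 0] and [k = 1] only;
    the loss factor is the exact ratio for [k = 2]. *)
Lemma weight_above k : b + k.+2%:R <= b * wratio ^+ k.+2 * wloss.
Proof.
have b0 := b_gt0.
elim: k => [|k IH].
  rewrite le_eqVlt; apply/orP; left; apply/eqP; rewrite ratioE lossE; field.
  by rewrite !lt0r_neq0 // addr_gt0.
have r0 : 0 <= wratio by apply: ltW; apply: lt_trans wratio_gt1.
have -> : b * wratio ^+ k.+3 * wloss = wratio * (b * wratio ^+ k.+2 * wloss).
  by rewrite exprS; ring.
apply: le_trans (ler_wpM2l r0 IH).
rewrite ratioE mulrAC ler_pdivlMr // -[k.+3%:R]natr1.
have := ler0n R k.+2; nra.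
Qed.

(** The same comparison below [b]. *)
Lemma weight_below k : k.+1%:R < b -> (b - k.+1%:R) * wratio ^+ k.+1 <= b * wloss.
Proof.
have b0 := b_gt0.
elim: k => [_|k IH hk].
  rewrite expr1 ratioE lossE -subr_ge0.
  have -> : b * (b * (b + 2) / ((b + 1) * (b + 1))) - (b - 1) * ((b + 1) / b) =
      (2 * b + 1) / (b * ((b + 1) * (b + 1))).
    by field; rewrite !lt0r_neq0 //; lra.
  by apply: divr_ge0; [lra | nra].
have hk' : k.+1%:R < b by apply: lt_trans hk; rewrite ltr_nat.
apply: le_trans (IH hk'); rewrite exprS mulrA ler_wpM2r //.
  by rewrite exprn_ge0 // ltW //; apply: lt_trans wratio_gt1.
rewrite ratioE mulrA ler_pdivrMr // -[k.+2%:R]natr1.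
have := ler0n R k.+1; nra.
Qed.

(** The logarithm lies below its secant line through [a - 1] and [a], strictly so at
    the other integers. *)
Lemma ln_weight_le w : (0 < w)%N ->
  ln (w%:R : R) <= ln b + (w%:R - b) * ln wratio +
     ((w != a - 1) && (w != a))%N%:R * ln wloss.
Proof.
move=> w0; have [l0 l1] := andP wloss_bounds.
have r0 : 0 < wratio by apply: lt_trans wratio_gt1.
have bE : b = (a - 1)%N%:R by rewrite natrB // ltnW.
have [ew|n1] := eqVneq w (a - 1)%N; first by rewrite ew -bE subrr !mul0r !addr0.
have [ew|n2] := eqVneq w a.
  rewrite ew mul0r addr0 {2}aE (_ : b + 1 - b = 1) ?mul1r; last by ring.
  by rewrite -lnM ?posrE // ratioE mulrCA divff ?mulr1 ?lt0r_neq0 // -aE.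
rewrite mul1r.
have [hw|hw] := ltnP w a.
  have [k hk] : exists k, (w + k.+1 = a - 1)%N by exists (a - 1 - w).-1; lia.
  have ew : w%:R = b - k.+1%:R by rewrite bE -hk natrD addrK.
  have h : ln ((b - k.+1%:R) * wratio ^+ k.+1) <= ln (b * wloss).
    rewrite ler_ln ?posrE ?mulr_gt0 ?exprn_gt0 // -?ew ?ltr0n //.
    by rewrite ew; apply: weight_below; rewrite -subr_gt0 -ew ltr0n.
  rewrite -ew in h.
  rewrite !lnM ?posrE ?exprn_gt0 ?ltr0n // lnXn // -[ln wratio *+ _]mulr_natl in h.
  rewrite {2}ew; lra.
have [k hk] : exists k, (w = a - 1 + k.+2)%N by exists (w - a - 1)%N; lia.
have ew : w%:R = b + k.+2%:R by rewrite hk natrD bE.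
have p0 : 0 < wratio ^+ k.+2 by apply: exprn_gt0.
have p1 : 0 < b * wratio ^+ k.+2 by apply: mulr_gt0.
have p2 : 0 < b * wratio ^+ k.+2 * wloss by apply: mulr_gt0.
have h : ln (b + k.+2%:R) <= ln (b * wratio ^+ k.+2 * wloss).
  by rewrite ler_ln ?posrE //; [exact: weight_above | rewrite -ew ltr0n].
rewrite -ew lnM ?posrE // lnM ?posrE // lnXn // -[ln wratio *+ _]mulr_natl in h.
by rewrite {2}ew; lra.
Qed.

Lemma ln_wratio_gt0 : 0 < ln wratio. Proof. exact/ln_gt0/wratio_gt1. Qed.

Lemma ln_wloss_lt0 : ln wloss < 0.
Proof. by have [l0 l1] := andP wloss_bounds; rewrite ln_lt0 // l0. Qed.

Lemma ln_edge_prod (V : finType) (G : multigraph V) :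
  (0 < edge_prod G)%N -> ln ((edge_prod G)%:R : R) = \sum_e ln (G e)%:R.
Proof.
rewrite /edge_prod => h.
have {}h e : (0 < G e)%N by move: h; rewrite (bigD1 e) //= muln_gt0 => /andP[].
suff: forall I : seq (edge V), ln ((\prod_(e <- I) G e)%N%:R : R) = \sum_(e <- I) ln (G e)%:R.
  by move=> /(_ (index_enum _)).
elim=> [|e I IH]; first by rewrite !big_nil ln1.
rewrite !big_cons natrM lnM ?IH // posrE ltr0n //.
by rewrite big_seq; apply: prodn_gt0 => f.
Qed.

(** The edges with a weight other than [a - 1] and [a]. *)
Definition odd_weight (V : finType) (G : multigraph V) (e : edge V) : bool :=
  (G e != a - 1)%N && (G e != a).

Lemma ln_edge_prod_le (V : finType) (G : multigraph V) : (0 < edge_prod G)%N ->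
  ln ((edge_prod G)%:R : R) <= 'C(#|V|, 2)%:R * ln b +
    (\sum_e excess a G e)%:~R * ln wratio + #|odd_weight G|%:R * ln wloss.
Proof.
move=> h; rewrite ln_edge_prod //.
have {}h e : (0 < G e)%N by move: h; rewrite /edge_prod (bigD1 e) //= muln_gt0 => /andP[].
apply: le_trans (ler_sum _ (fun e _ => ln_weight_le (h e))) _.
rewrite big_split /= big_split /= sumr_const -card_edge -[_ *+ #|_|]mulr_natl -!mulr_suml.
rewrite le_eqVlt; apply/orP; left; apply/eqP; congr (_ + _ * _ + _ * _).
  rewrite rmorph_sum /=; apply: eq_bigr => e _.
  by rewrite /excess rmorphB rmorphB /= -!pmulrn.
rewrite -natr_sum -sum1_card [in RHS]big_mkcond /=; congr (_%:R).
Qed.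

End LogWeight.

(** * The extremal number *)

Lemma set_max_eq (A : set nat) m : A m -> (forall k, A k -> (k <= m)%N) ->
  set_max A = m.
Proof.
move=> Am mA; apply: xget_unique => // k [Ak kA].
by apply/eqP; rewrite eqn_leq mA // kA.
Qed.

(** The common product of the Turan multigraphs. *)
Definition turan_prod (r a n : nat) : nat :=
  ((a - 1) ^ ('C(n, 2) - turan_edges r n) * a ^ turan_edges r n)%N.

Section TuranProd.
Variables (R : realType) (r a : nat).
Hypothesis r0 : (0 < r)%N.
Hypothesis a2 : (2 <= a)%N.

Lemma turan_prod_gt0 n : (0 < turan_prod r a n)%N.
Proof. by rewrite /turan_prod muln_gt0 !expn_gt0; apply/andP; split; lia. Qed.

Lemma turan_prodE n : (turan_prod r a n)%:R =
  (a%:R - 1) ^+ 'C(n, 2) * (a%:R / (a%:R - 1)) ^+ turan_edges r n :> R.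
Proof.
have b0 : (a%:R - 1 : R) != 0 by have := base_ge1 R a2; lra.
rewrite /turan_prod natrM !natrX natrB; last by lia.
rewrite -{2}(subnK (turan_edges_le n r0)) exprD -mulrA -exprMn.
by rewrite mulrCA divff // mulr1.
Qed.

Lemma ln_turan_prod n : ln (turan_prod r a n)%:R =
  'C(n, 2)%:R * ln (a%:R - 1) + (turan_edges r n)%:R * ln (wratio R a).
Proof.
have b0 : 0 < a%:R - 1 :> R by have := base_ge1 R a2; lra.
have r1 : 0 < wratio R a by have := wratio_gt1 R a2; lra.
rewrite turan_prodE -/(wratio R a) lnM ?posrE ?exprn_gt0 // !lnXn //.
by rewrite -[_ *+ 'C(n, 2)]mulr_natl -[ln (wratio R a) *+ _]mulr_natl.
Qed.

End TuranProd.

Section Extremal.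
Variables (R : realType) (s q a t r n : nat).
Hypothesis a2 : (2 <= a)%N.
Hypothesis qE : (q + t = a * 'C(s, 2))%N.
Hypothesis sE : s = (r + t)%N.
Hypothesis t_bounds : (0 < t <= r)%N.
Hypothesis sn : (s <= n)%N.
Implicit Types G : multigraph 'I_n.

Let r0 : (0 < r)%N. Proof. lia. Qed.

Let u G := pair_fun (excess a G).

Lemma sq_graph_sets G : sq_graph s q G -> forall X : {set 'I_n}, #|X| = (r + t)%N ->
  wsum (u G) X <= (r + t)%N%:Z * ((r + t)%N%:Z - 1) - t%:Z *+ 2.
Proof. by move=> /(sq_graph_wsum _ qE); rewrite sE. Qed.

Lemma wsum_le_turan G (A : {set 'I_n}) : sq_graph s q G -> (s <= #|A|)%N ->
  wsum (u G) A <= turan2 r #|A|.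
Proof.
move=> hG; rewrite sE; apply: (@wsum_le_turan2 _ _ _ _ r t) => //.
- exact: pair_fun_sym.
- exact: pair_fun_diag.
- exact: sq_graph_sets.
Qed.

Lemma sum_excess_le G : sq_graph s q G -> \sum_e excess a G e <= (turan_edges r n)%:Z.
Proof.
move=> hG; have := wsum_le_turan (A := [set: 'I_n]%SET) hG.
by rewrite cardsT card_ord => /(_ sn); rewrite wsum_pair_funT -turan_edges2 //; rewrite lerMn2r.
Qed.

(** The deficit of the logarithm of the product controls both the deficit of the
    sum and the number of weights other than [a - 1] and [a]. *)
Lemma ln_edge_prod_deficit G : sq_graph s q G -> (0 < edge_prod G)%N ->
  (((turan_edges r n)%:Z - \sum_e excess a G e)%:~R * ln (wratio R a)
    + #|odd_weight a G|%:R * - ln (wloss R a)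
    <= ln (turan_prod r a n)%:R - ln (edge_prod G)%:R).
Proof.
move=> hG G0; have := ln_edge_prod_le R a2 G0; rewrite card_ord ln_turan_prod //.
rewrite rmorphB /= -pmulrn; lra.
Qed.

Lemma edge_prod_le G : sq_graph s q G -> (edge_prod G <= turan_prod r a n)%N.
Proof.
move=> hG; have [->//|G0] := posnP (edge_prod G).
have h := ln_edge_prod_deficit hG G0.
have : 0 <= ((turan_edges r n)%:Z - \sum_e excess a G e)%:~R * ln (wratio R a).
  rewrite mulr_ge0 ?ler0z ?subr_ge0 ?sum_excess_le //.
  exact/ltW/ln_wratio_gt0.
have : 0 <= #|odd_weight a G|%:R * - ln (wloss R a).
  by rewrite mulr_ge0 // oppr_ge0 ltW // ln_wloss_lt0.
move=> h1 h2; rewrite -(ler_nat R) -ler_ln ?posrE ?ltr0n ?turan_prod_gt0 //.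
lra.
Qed.

Lemma turan_sq_graph (c : 'I_n -> 'I_r) : sq_graph s q (color_graph c a).
Proof. by apply: color_graph_sq qE _; rewrite ?card_ord // ltnW. Qed.

Lemma ex_prodE : ex_prod n s q = turan_prod r a n.
Proof.
apply: set_max_eq => [|k [G hG <-]]; last exact: edge_prod_le.
exists (color_graph (@mod_color r n r0) a); first exact: turan_sq_graph.
by rewrite (edge_prod_turan _ r0) //; [exact: ltnW | exact: balanced_mod].
Qed.

Lemma turan_extremal : (turan_multigraphs r a n `<=` extremal_graphs n s q)%classic.
Proof.
move=> G /turan_multigraphsP[||c bal ->]; try lia.
split; first exact: turan_sq_graph.
by rewrite ex_prodE (edge_prod_turan _ r0) // ltnW.
Qed.

(** An extremal multigraph only has the weights [a - 1] and [a], and as much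
    total weight as a Turan multigraph. *)
Lemma extremal_weights G : extremal_graphs n s q G ->
  (forall x y, u G x y = 0 \/ u G x y = 1) /\
  wsum (u G) [set: 'I_n]%SET = turan2 r n.
Proof.
move=> [hG]; rewrite ex_prodE => hP.
have := ln_edge_prod_deficit hG; rewrite hP => /(_ (turan_prod_gt0 r0 a2 n)).
rewrite subrr => h.
have le1 := sum_excess_le hG.
have lr := ln_wratio_gt0 R a2; have ll := ln_wloss_lt0 R a2.
set D := (_ - _)%:~R in h; have D0 : 0 <= D by rewrite /D ler0z subr_ge0.
have [B0|B0] := posnP #|odd_weight a G|; last first.
  have : 0 < #|odd_weight a G|%:R * - ln (wloss R a).
    by rewrite mulr_gt0 ?ltr0n // oppr_gt0.
  have : 0 <= D * ln (wratio R a) by rewrite mulr_ge0 // ltW.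
  by move=> h1 h2; exfalso; move: (ltr_wpDl h1 h2); rewrite ltNge h.
rewrite B0 mul0r addr0 pmulr_lle0 // in h.
have {}h : \sum_e excess a G e = (turan_edges r n)%:Z.
  by move: h; rewrite /D lerz0; lia.
split; last by rewrite wsum_pair_funT h turan_edges2.
move=> x y; have [->|xy] := eqVneq x y; first by left; apply: pair_fun_diag.
rewrite /u; have [e _ ->] := pair_funP (excess a G) xy.
have /negbT : odd_weight a G e = false by have /card0_eq/(_ e) := B0; rewrite -topredE.
rewrite /odd_weight negb_and !negbK /excess => /orP[]/eqP->; [left|right]; lia.
Qed.

(** Extremal multigraphs without dense sets of [r + 1] vertices are Turan
    multigraphs. *)
Lemma extremal_turan G : extremal_graphs n s q G ->
  (forall Q : {set 'I_n}, #|Q| = r.+1 -> wsum (u G) Q < r.+1%:Z * r%:Z) ->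
  turan_multigraphs r a n G.
Proof.
move=> hG hQ; have [u01 eT] := extremal_weights hG.
have := @turan_unique _ (u G) r (@pair_fun_sym _ _ _) (@pair_fun_diag _ _ _) u01 r0 hQ [set: 'I_n]%SET.
rewrite cardsT card_ord => /(_ eT)[c bal hc].
apply/turan_multigraphsP; [exact: ltnW | lia |].
exists c => //; apply/ffunP => e.
have [[x y] xy he] := edge_witness e; rewrite [(x, y).1]/= [(x, y).2]/= in xy he.
have := hc x y; rewrite !inE => /(_ isT isT).
rewrite /u (pair_fun_edge _ he) ffunE (bichromatic_pair c he) /excess => h.
have {}h : (G e)%:Z - (a%:Z - 1) = (c x != c y)%:Z :> int := h.
move: h; case: (c x != c y) => h; apply/eqP; rewrite -eqz_nat; apply/eqP; move: h; set g := G e; lia.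
Qed.

Lemma extremal_turan1 G : t = 1%N -> extremal_graphs n s q G -> turan_multigraphs r a n G.
Proof.
move=> t1 hG; apply: extremal_turan (hG) _ => Q cQ.
have := sq_graph_sets hG.1 (X := Q); rewrite cQ t1 addn1 => /(_ erefl); lia.
Qed.

(** For large [n], the degrees of an extremal multigraph are at least those of the
    Turan graph on [n] vertices, since otherwise deleting a vertex would violate the
    bound on sums for [n - 1] vertices. So dense sets are excluded. *)
Lemma extremal_turan_large G : (s + 10 * r ^ 3 < n)%N ->
  extremal_graphs n s q G -> turan_multigraphs r a n G.
Proof.
move=> n_large hG; apply: extremal_turan (hG) _ => Q cQ.
have [u01 eT] := extremal_weights hG.
have us := @pair_fun_sym _ _ (excess a G); have ud := @pair_fun_diag _ _ (excess a G).
pose d : int := n.-1%:Z - (n.-1 %/ r)%N%:Z.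
apply: (@no_dense_set _ (u G) us ud r t [set: 'I_n]%SET Q d 1) => //.
- exact: sq_graph_sets hG.1.
- move=> x xA; have := wsumD1 us ud xA; rewrite -/(u G) eT.
  have cx : #|[set: 'I_n]%SET :\ x| = n.-1.
    by have := cardsT 'I_n; rewrite (cardsD1 x) xA card_ord; lia.
  have := wsum_le_turan (A := [set: 'I_n]%SET :\ x) hG.1; rewrite cx.
  move=> /(_ ltac:(lia)).
  have -> : turan2 r n = turan2 r n.-1.+1 by congr turan2; lia.
  rewrite turan2S // /d; lia.
- by move=> x y; case: (u01 x y) => ->.
- move=> K /andP[rK Krt]; rewrite cardsT card_ord /d.
  have hm := divn_eq n.-1 r; set p := (n.-1 %/ r)%N in hm *.
  have hp : (p * r < n)%N by lia.
  have e3 : (r ^ 3 = r * r * r)%N by rewrite !expnS expn0; lia.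
  rewrite e3 in n_large.
  have K2 : (K + 1 <= r * 2)%N by lia.
  have h1 : r%:Z * p%:Z <= n%:Z - 1 by lia.
  have h2 : (K * K <= (r * 2) * (r * 2))%N by apply: leq_mul; lia.
  have h3 : (r * (K * K) <= 4 * (r * r * r))%N by nia.
  have h4 : (K * r <= 2 * (r * r * r))%N by nia.
  have h5 : (n <= (2 * r - K) * n)%N by rewrite leq_pmull //; lia.
  have h6 : K%:Z * (r%:Z * p%:Z) <= K%:Z * (n%:Z - 1) by rewrite ler_wpM2l.
  have h7 : n%:Z <= (r%:Z *+ 2 - K%:Z) * n%:Z by nia.
  rewrite -(@ltr_pM2l _ r%:Z) //; lia.
Qed.

End Extremal.

(** * The limit *)

(** The edge density of the Turan graph tends to [(r - 1) / r] at speed [1 / n]. *)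
Lemma turan_edges_ratio_dist (R : realType) (r n : nat) : (0 < r)%N -> (r < n)%N ->
  `|(turan_edges r n)%:R / 'C(n, 2)%:R - (r%:R - 1) / r%:R| <= 6 * harmonic n :> R.
Proof.
move=> r0 rn; rewrite /harmonic /=.
have h2 := turan_edges2 n r0; have hl := turan2_le n r0; have hg := turan2_ge n r0.
rewrite -h2 in hl hg; have hb := bin2_mul2 n.
set E := turan_edges r n in h2 hl hg *; set N := 'C(n, 2) in hb *.
have hb' : N%:Z *+ 2 = n%:Z * (n%:Z - 1) by have [m em] : exists m, n = m.+1 by [exists n.-1; lia]; move: hb; rewrite em /=; lia.
have N0 : (0 < N)%N by rewrite bin_gt0; lia.
(* [r E - (r - 1) N] is of order [n], and [r N] of order [n ^ 2]. *)
have hu : r%:Z * E%:Z - (r%:Z - 1) * N%:Z <= r%:Z * n%:Z by nia.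
have hd : - (r%:Z * n%:Z) <= r%:Z * E%:Z - (r%:Z - 1) * N%:Z by nia.
have rR : (0 < r%:R :> R) by rewrite ltr0n.
have NR : (0 < N%:R :> R) by rewrite ltr0n.
have -> : E%:R / N%:R - (r%:R - 1) / r%:R = (r%:R * E%:R - (r%:R - 1) * N%:R) / (r%:R * N%:R) :> R.
  by field; rewrite !lt0r_neq0.
have toR (x y : int) : x <= y -> x%:~R <= y%:~R :> R by rewrite ler_int.
move/toR: hu; move/toR: hd.
rewrite !rmorphB /= !rmorphM /= !rmorphB /= rmorphN !rmorphM /= -!pmulrn => hd hu.
have hN : n%:R * (n%:R + 1) <= 6 * N%:R :> R.
  by rewrite natr1 -!natrM ler_nat; have [m em] : exists m, n = m.+2 by [exists (n - 2)%N; lia]; move: hb; rewrite em /=; lia.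
rewrite normrM normfV (ger0_norm (ltW (mulr_gt0 rR NR))) ler_pdivrMr ?mulr_gt0 //.
have n1 : (0 < n.+1%:R :> R) by rewrite ltr0n.
rewrite mulrAC ler_pdivlMr // -natr1.
apply: (@le_trans _ _ (r%:R * n%:R * (n%:R + 1))).
  by rewrite ler_wpM2r ?addr_ge0 // ler_norml hd hu.
by have := ler_wpM2l (ltW rR) hN; lra.
Qed.

Lemma cvg_ex_prod_root (R : realType) (s q a t r : nat) :
  (2 <= a)%N -> (q + t = a * 'C(s, 2))%N -> s = (r + t)%N -> (0 < t <= r)%N ->
  (ex_prod_root R s q n @[n --> \oo] -->
    (a%:R - 1) * (a%:R / (a%:R - 1)) `^ ((r%:R - 1) / r%:R))%classic.
Proof.
move=> a2 qE sE tr; have r0 : (0 < r)%N by lia.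
have b0 : 0 < a%:R - 1 :> R by have := base_ge1 R a2; lra.
have r1 : 0 < wratio R a by have := wratio_gt1 R a2; lra.
pose c : R := (r%:R - 1) / r%:R.
pose x n : R := (turan_edges r n)%:R / 'C(n, 2)%:R.
have cx : (x n @[n --> \oo] --> c)%classic.
  apply: (@squeeze_cvgr _ _ _ _ (fun n => c - 6 * harmonic n) (fun n => c + 6 * harmonic n)).
  - near=> n; have rn : (r < n)%N by near: n; exact: nbhs_infty_gt.
    by have := turan_edges_ratio_dist R r0 rn; rewrite ler_distl.
  - have : (c - 6 * harmonic n @[n --> \oo] --> c - 6 * 0)%classic.
      apply: cvgB; first exact: cvg_cst.
      by apply: cvgM; [exact: cvg_cst | exact: cvg_harmonic].
    by rewrite mulr0 subr0.
  - have : (c + 6 * harmonic n @[n --> \oo] --> c + 6 * 0)%classic.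
      apply: cvgD; first exact: cvg_cst.
      by apply: cvgM; [exact: cvg_cst | exact: cvg_harmonic].
    by rewrite mulr0 addr0.
have -> : (a%:R - 1) * (a%:R / (a%:R - 1)) `^ ((r%:R - 1) / r%:R) =
    expR (ln (a%:R - 1) + c * ln (wratio R a)).
  by rewrite expRD lnK ?posrE // /powR -/(wratio R a) gt_eqF.
have : (expR (ln (a%:R - 1) + x n * ln (wratio R a)) @[n --> \oo] -->
    expR (ln (a%:R - 1) + c * ln (wratio R a)))%classic.
  apply: continuous_cvg; first exact: continuous_expR.
  by apply: cvgD; [exact: cvg_cst | apply: cvgM => //; exact: cvg_cst].
apply: cvg_trans; apply: near_eq_cvg; near=> n.
have sn : (s <= n)%N by near: n; exact: nbhs_infty_ge.
rewrite /ex_prod_root (ex_prodE R a2 qE sE tr sn) /powR gt_eqF ?ltr0n ?turan_prod_gt0 //.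
rewrite ln_turan_prod // /x; congr expR.
by field; rewrite pnatr_eq0 -lt0n bin_gt0; lia.
Unshelve. all: by end_near. Qed.

(** * Structure under a minimum degree condition *)

Section NearTuran.
Variables (V : finType) (f : V -> V -> int) (r : nat) (A : {set V}) (b : int).
Hypothesis f_sym : forall x y, f x y = f y x.
Hypothesis f_diag : forall x, f x x = 0.
Hypothesis f_le1 : forall x y, f x y <= 1.
Hypothesis r0 : (0 < r)%N.

(** Sets all pairs of which have weight one. *)
Definition full_clique (Q : {set V}) : Prop :=
  {in Q &, forall x y, x != y -> f x y = 1}.

Hypothesis no_full_clique :
  forall Q : {set V}, Q \subset A -> #|Q| = r.+1 -> ~ full_clique Q.
Hypothesis deg_ge : forall x, x \in A -> #|A|%:Z - b <= deg_in f x A.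

(** The error parameter: it vanishes when [b] is [#|A| / r], the degree deficit
    of the complete balanced [r]-partite graph on [A]. *)
Definition defect : int := r%:Z * b - #|A|%:Z.

Hypothesis defect_ge0 : 0 <= defect.
Hypothesis b_large : r%:Z * r%:Z < b - defect *+ 2.
Hypothesis A0 : A != finset.set0.

Lemma b_ge0 : 0 <= b.
Proof.
have [x xA] := set0Pn _ A0.
have : deg_in f x A <= \sum_(y in A) 1 by apply: ler_sum.
by rewrite sumr_const natz => /(le_trans (deg_ge xA)); rewrite lerBlDr lerDl.
Qed.

Lemma full_cliqueU1 x (Q : {set V}) : full_clique Q ->
  (forall y, y \in Q -> f x y = 1) -> full_clique (x |: Q).
Proof.
move=> hQ hx y z; rewrite !inE => /predU1P[->|yQ] /predU1P[->|zQ]; rewrite ?eqxx //.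
- by move=> _; apply: hx.
- by move=> _; rewrite f_sym; apply: hx.
- exact: hQ.
Qed.

Lemma deg_in_full x (Q : {set V}) : #|Q|%:Z <= deg_in f x Q ->
  forall y, y \in Q -> f x y = 1.
Proof.
move=> h y yQ; have := f_le1 x y; rewrite le_eqVlt => /predU1P[//|hy].
have : deg_in f x (Q :\ y) <= \sum_(z in Q :\ y) 1 by apply: ler_sum.
move: h; rewrite (deg_inD1 _ _ yQ) sumr_const natz (cardsD1 y) yQ; lia.
Qed.

Lemma exists_full_clique k : (0 < k <= r)%N ->
  exists Q : {set V}, [/\ Q \subset A, #|Q| = k & full_clique Q].
Proof.
have b0 := b_ge0.
have hb : r%:Z * r%:Z < #|A|%:Z - (r%:Z - 1) * b by move: b_large defect_ge0; rewrite /defect; lia.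
elim: k => [//|[_ _|k IH kr]].
  have [x xA] := set0Pn _ A0; exists [set x]%SET; split; rewrite ?finset.sub1set ?cards1 //.
  by move=> y z; rewrite !inE => /eqP-> /eqP->; rewrite eqxx.
have [|Q [QA cQ hQ]] := IH; first lia.
have [//|//||x] := @extend_set _ f f_sym A Q (#|A|%:Z - b) k%:Z 1 QA deg_ge f_le1.
  rewrite cQ; have k1 : k.+1%:Z <= r%:Z - 1 by lia.
  have : k.+1%:Z * b <= (r%:Z - 1) * b by rewrite ler_wpM2r.
  have : (k.+1 * k.+1 <= r * r)%N by apply: leq_mul; lia.
  lia.
rewrite inE => /andP[xQ xA] hx; exists (x |: Q); split.
- by rewrite finset.subUset finset.sub1set xA.
- by rewrite cardsU1 xQ cQ.
- by apply: full_cliqueU1 => //; apply: deg_in_full; rewrite cQ; lia.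
Qed.

(** The set [W] consists of the vertices of [A] joined to all vertices of a clique on
    [r] vertices but one, which is the label. *)
Lemma near_turan : exists (W : {set V}) (lab : V -> 'I_r),
  [/\ W \subset A, #|A|%:Z - #|W|%:Z <= defect,
      forall i, b - defect *+ 2 <= #|color_class lab W i|%:Z &
      forall x, x \in W ->
        #|[set y in W | f x y != (lab x != lab y)%:Z]%SET|%:Z <= defect *+ 2].
Proof.
have b0 := b_ge0.
have [Q [QA cQ hQ]] := @exists_full_clique r ltac:(lia).
pose q (i : 'I_r) : V := enum_val (cast_ord (esym cQ) i).
have qQ i : q i \in Q by apply: enum_valP.
have q_inj : injective q by move=> i j /enum_val_inj/cast_ord_inj.
have sumQ x : deg_in f x Q = \sum_i f x (q i).
  have -> : Q = [set q i | i : 'I_r]%SET.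
    apply/eqP; rewrite eq_sym eqEcard card_imset // card_ord cQ leqnn andbT.
    by apply/fintype.subsetP => y /imsetP[i _ ->].
  by rewrite /deg_in big_imset //= => i j _ _; apply: q_inj.
have fq i j : i != j -> f (q i) (q j) = 1 by move=> ij; apply: hQ; rewrite ?inj_eq.
have deg_lt x : x \in A -> deg_in f x Q <= r%:Z - 1.
  move=> xA; have [xQ|xQ] := boolP (x \in Q).
    rewrite (deg_inD1 _ _ xQ) f_diag add0r.
    have : deg_in f x (Q :\ x) <= \sum_(z in Q :\ x) 1 by apply: ler_sum.
    by rewrite sumr_const natz; have := cQ; rewrite (cardsD1 x) xQ; lia.
  rewrite leNgt; apply/negP => h; apply: (@no_full_clique (x |: Q)).
  - by rewrite finset.subUset finset.sub1set xA.
  - by rewrite cardsU1 xQ cQ.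
  - by apply: full_cliqueU1 => //; apply: deg_in_full; rewrite cQ; lia.
(* The degrees of the clique add up to almost the maximum [(r - 1) * #|A|]
   allowed by [deg_lt], so that [deg_lt] is an equality for almost all vertices. *)
pose W := [set x in A | deg_in f x Q == r%:Z - 1]%SET.
have WA : W \subset A by apply/fintype.subsetP => x; rewrite inE => /andP[].
have cW : #|A|%:Z - #|W|%:Z <= defect.
  have h1 : r%:Z * (#|A|%:Z - b) <= \sum_(x in A) deg_in f x Q.
    have -> : \sum_(x in A) deg_in f x Q = \sum_(v in Q) deg_in f v A.
      rewrite /deg_in exchange_big /=.
      by apply: eq_bigr => x _; apply: eq_bigr => y _; apply: f_sym.
    rewrite -cQ -natz mulr_natl -sumr_const; apply: ler_sum => v vQ.
    by apply: deg_ge; apply: (fintype.subsetP QA).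
  have h2 : \sum_(x in A) deg_in f x Q <= (r%:Z - 1) * #|A|%:Z - (#|A|%:Z - #|W|%:Z).
    rewrite (big_setID W) /= (finset.setIidPr WA).
    have cD := cardsD A W; rewrite (finset.setIidPr WA) in cD.
    have cWA := subset_leq_card WA.
    have {cD} eA : #|A|%:Z = #|W|%:Z + #|A :\: W|%:Z by rewrite cD; lia.
    have : \sum_(x in W) deg_in f x Q <= \sum_(x in W) (r%:Z - 1).
      by apply: ler_sum => x /(fintype.subsetP WA); apply: deg_lt.
    have : \sum_(x in A :\: W) deg_in f x Q <= \sum_(x in A :\: W) (r%:Z - 2).
      apply: ler_sum => x; rewrite !inE => /andP[]; move=> + xA; rewrite xA /= => h.
      by have := deg_lt x xA; rewrite le_eqVlt (negbTE h) /=; lia.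
    rewrite !sumr_const -[_ *+ #|W|]mulr_natr -[_ *+ #|_ :\: _|]mulr_natr !natz eA.
    by move=> ha hb; apply: le_trans (lerD hb ha) _; lia.
  rewrite /defect; lia.
pose lab x := odflt (Ordinal r0) [pick i | f x (q i) != 1].
have labP x : x \in W -> forall i, f x (q i) = (i != lab x)%:Z.
  rewrite inE => /andP[xA /eqP]; rewrite sumQ => hx.
  have [i0 hi0] : exists i, f x (q i) != 1.
    apply: contrapT => h; have h' i : f x (q i) = 1.
      by apply/eqP; apply: contrapT => hi; apply: h; exists i; apply/negP.
    by move: hx; under eq_bigr do rewrite h'; rewrite sumr_const card_ord natz; lia.
  have others i : f x (q i) != 1 ->
     f x (q i) = 0 /\ forall j, j != i -> f x (q j) = 1.
    move=> hi; have li : f x (q i) <= 0 by have := f_le1 x (q i); move: hi; lia.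
    have ej j : j != i -> f x (q j) = 1.
      move=> ji; apply/eqP; apply: contrapT => /negP hj.
      have lj : f x (q j) <= 0 by have := f_le1 x (q j); move: hj; lia.
      move: hx; rewrite (bigD1 i) //= (bigD1 j) //=.
      have : \sum_(k | (k != i) && (k != j)) f x (q k) <= \sum_(k | (k != i) && (k != j)) 1.
        exact: ler_sum.
      have : \sum_(k < r) (1 : int) = r%:Z by rewrite sumr_const card_ord natz.
      rewrite (bigD1 i) //= (bigD1 j) //=.
      move: (\sum_(k | _) f x (q k)) (\sum_(k | _) (1 : int)) => S1 S2; lia.
    split=> //; move: hx; rewrite (bigD1 i) //=.
    under eq_bigr => j ji do rewrite (ej j ji).
    have : \sum_(k < r) (1 : int) = r%:Z by rewrite sumr_const card_ord natz.
    rewrite (bigD1 i) //=; move: (\sum_(k | _) (1 : int)) => S2; lia.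
  rewrite /lab; case: pickP => [i /= hi j|]; last by move/(_ i0); rewrite hi0.
  by have [h0 h1] := others i hi; case: (eqVneq j i) => [->|/h1].
(* Two joined vertices with the same label would form a clique on [r + 1] vertices
   with the other vertices of the clique. *)
have indep x y : x \in W -> y \in W -> lab x = lab y -> f x y <= 0.
  move=> xW yW lxy; have [->|xy] := eqVneq x y; first by rewrite f_diag.
  rewrite leNgt; apply/negP => fxy.
  have {}fxy : f x y = 1 by have := f_le1 x y; lia.
  pose Q' := Q :\ q (lab x).
  have lx z w : z \in W -> lab z = lab x -> w \in Q' -> f z w = 1.
    move=> zW lz; rewrite !inE => /andP[wx wQ].
    have [i ei] : exists i, w = q i.
      exists (cast_ord cQ (enum_rank_in wQ w)).
      by rewrite /q cast_ordK enum_rankK_in.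
    have il : i != lab x by apply: contraNneq wx => il; rewrite ei il.
    by rewrite ei (labP z zW) lz il.
  have nQ' z : z \in W -> lab z = lab x -> z \notin Q'.
    by move=> zW lz; apply/negP => /(lx z z zW lz); rewrite f_diag.
  have Q'c : full_clique Q'.
    by move=> z w; rewrite !inE => /andP[_ zQ] /andP[_ wQ]; apply: hQ.
  apply: (@no_full_clique (x |: (y |: Q'))).
  - rewrite !finset.subUset !finset.sub1set !(fintype.subsetP WA) //=.
    by apply: fintype.subset_trans QA; apply: finset.subsetDl.
  - rewrite !cardsU1 in_setU1 negb_or xy !nQ' //=.
    by rewrite -cQ (cardsD1 (q (lab x)) Q) qQ -/Q'; lia.
  - apply: full_cliqueU1; first by apply: full_cliqueU1 => // w; apply: lx.
    by move=> w; rewrite in_setU1 => /predU1P[->//|]; apply: lx.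
have class_deg x : x \in W -> let C := color_class lab W (lab x) in
    \sum_(y in A) ((y \notin C)%:Z - f x y) <= b - #|C|%:Z.
  move=> xW /=; set C := color_class lab W (lab x); rewrite big_split /= sumrN.
  have -> : \sum_(y in A) (y \notin C)%:Z = #|A|%:Z - #|C|%:Z.
    have CA : C \subset A.
      by apply: fintype.subset_trans WA; apply/fintype.subsetP => y; rewrite inE => /andP[].
    rewrite (big_setID C) /= (finset.setIidPr CA) big1 ?add0r; last by move=> y ->.
    rewrite (eq_bigr (fun=> 1)); last by move=> y; rewrite !inE => /andP[/negbTE -> _].
    rewrite sumr_const natz cardsD (finset.setIidPr CA).
    by have := subset_leq_card CA; lia.
  by rewrite -/(deg_in f x A); have := deg_ge (fintype.subsetP WA x xW); lia.
have term_ge0 x y : x \in W -> 0 <= (y \notin color_class lab W (lab x))%:Z - f x y.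
  move=> xW; rewrite in_color_class; case: andP => [[yW /eqP ly]|_] /=.
    by have := indep x y xW yW (esym ly); lia.
  by have := f_le1 x y; lia.
have class_le i : #|color_class lab W i|%:Z <= b.
  have [->|] := eqVneq (color_class lab W i) finset.set0; first by rewrite cards0.
  case/set0Pn => x; rewrite inE => /andP[xW /eqP <-].
  have := class_deg x xW; rewrite /=.
  have : 0 <= \sum_(y in A) ((y \notin color_class lab W (lab x))%:Z - f x y).
    by apply: sumr_ge0 => y _; apply: term_ge0.
  by move=> p1 p2; have := le_trans p1 p2; lia.
have class_ge i : b - defect *+ 2 <= #|color_class lab W i|%:Z.
  have hs := sumz_card_class lab W; rewrite (bigD1 i) //= in hs.
  have hle : \sum_(j | j != i) #|color_class lab W j|%:Z <= \sum_(j | j != i) b by apply: ler_sum.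
  have hb : \sum_(j < r) b = r%:Z * b by rewrite sumr_const card_ord -mulr_natl natz.
  rewrite (bigD1 i) //= in hb.
  have {}hb : b - #|color_class lab W i|%:Z <= r%:Z * b - #|W|%:Z by rewrite -hs -hb opprD addrACA lerDl subr_ge0.
  by move: cW; rewrite /defect; lia.
exists W, lab; split => // x xW.
have h1 := class_deg x xW; rewrite /= in h1.
have h2 := class_ge (lab x).
apply: (@le_trans _ _ (\sum_(y in A) ((y \notin color_class lab W (lab x))%:Z - f x y))).
  2: by apply: le_trans h1 _; lia.
set S := [set y in W | _]%SET.
have SA : S \subset A.
  by apply: fintype.subset_trans WA; apply/fintype.subsetP => y; rewrite inE => /andP[].
rewrite (big_setID S) /= (finset.setIidPr SA) -[X in X <= _]addr0 -[#|S|%:Z]natz -sumr_const.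
apply: lerD; last by apply: sumr_ge0 => y _; apply: term_ge0.
apply: ler_sum => y; rewrite inE => /andP[yW]; have := term_ge0 x y xW.
by rewrite in_color_class yW /= [lab y == _]eq_sym; lia.
Qed.

End NearTuran.

(** A partial labelling all classes of which are large agrees with a balanced
    colouring on a large set. *)
Lemma balanced_recolor (n r l : nat) (lab : 'I_n -> 'I_r) (W : {set 'I_n}) :
  (0 < r)%N -> (forall i, l <= #|color_class lab W i|)%N ->
  exists2 c : 'I_n -> 'I_r, balanced c [set: 'I_n]%SET &
    (r * minn l (n %/ r) <= #|[set x in W | c x == lab x]%SET|)%N.
Proof.
move=> r0 hl.
pose col (s : {perm 'I_n}) x := mod_color r0 (s x).
have bal s : balanced (col s) [set: 'I_n]%SET.
  have e i : color_class (col s) [set: 'I_n]%SET i =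
      s @^-1: color_class (mod_color r0) [set: 'I_n]%SET i.
    by apply/setP => x; rewrite !inE.
  by move=> i j; rewrite !e !card_preimset; [apply: balanced_mod | apply: perm_inj..].
pose agr s := [set x in W | col s x == lab x]%SET.
(* Among the colourings obtained by permuting the vertices, take one that agrees
   with the labelling as much as possible. *)
have [s smax] : exists s : {perm 'I_n}, forall s', (#|agr s'| <= #|agr s|)%N.
  case: (@arg_maxnP _ (1%g : {perm 'I_n}) xpredT (fun s => #|agr s|) isT) => s _ h.
  by exists s => // s'; apply: h.
exists (col s) => //.
have swap x y : x \in W -> col s x != lab x -> col s y = lab x ->
    (y \in W) && (lab y == lab x).
  move=> xW cx cy; apply: contraT => hy.
  have := smax (tperm x y * s)%g; rewrite leqNgt => /negP[].
  apply: proper_card; apply/fintype.properP; split.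
    apply/fintype.subsetP => z; rewrite !inE => /andP[zW /eqP cz]; rewrite zW /= /col permM.
    rewrite tpermD; first exact/eqP.
      by apply: contraNneq cx => ->; rewrite cz.
    by apply: contraNneq hy => yz; rewrite yz in cy; rewrite yz zW -cz cy eqxx.
  exists x; last by rewrite inE xW.
  by rewrite inE xW /= /col permM tpermL -cy.
have agr_i i : (minn l (n %/ r) <= #|color_class (col s) (agr s) i|)%N.
  have [/existsP[x /and3P[xW /eqP lx cx]]|] :=
    boolP [exists x, [&& x \in W, lab x == i & col s x != i]].
    apply: leq_trans (geq_minr _ _) _.
    have /andP[h _] := balanced_card i (bal s); rewrite cardsT !card_ord in h.
    apply: leq_trans h _; apply: subset_leq_card; apply/fintype.subsetP => y.
    rewrite !inE => /andP[_ /eqP cy].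
    have := swap x y xW; rewrite lx => /(_ cx cy)/andP[-> /eqP->].
    by rewrite cy eqxx.
  rewrite negb_exists => /forallP h.
  apply: leq_trans (geq_minl _ _) _; apply: leq_trans (hl i) _.
  apply: subset_leq_card; apply/fintype.subsetP => y; rewrite !inE => /andP[yW ly].
  by have := h y; rewrite yW ly /= negbK => /eqP ->; rewrite (eqP ly) eqxx.
rewrite -/(agr s) -(sum_card_class (col s) (agr s)).
apply: (@leq_trans (\sum_(i < r) minn l (n %/ r))); last exact: leq_sum.
by rewrite sum_nat_const card_ord.
Qed.

(** * Stability *)

Lemma sq_graph_weight_le (V : finType) (s q : nat) (G : multigraph V) (e : edge V) :
  (2 <= s <= #|V|)%N -> sq_graph s q G -> (G e <= q)%N.
Proof.
move=> /andP[s2 sV] hG.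
have [X [cX eX]] : exists X : {set V}, #|X| = s /\ val e \subset X.
  have ce : #|val e| = 2%N by apply/eqP; apply: valP e.
  have cC : #|~: val e| = (#|V| - 2)%N by rewrite cardsCs finset.setCK ce.
  pose B := [set x in take (s - 2) (enum (~: val e))]%SET.
  have BE : #|B| = (s - 2)%N.
    rewrite cardsE (card_uniqP _) ?take_uniq ?enum_uniq // size_take -cardE cC.
    by case: ltnP; lia.
  exists (val e :|: B); rewrite finset.subsetUl; split => //.
  rewrite cardsU BE ce (_ : val e :&: B = finset.set0) ?cards0; first lia.
  apply/setP => x; rewrite !inE; apply/andP => -[xe /mem_take].
  by rewrite mem_enum !inE xe.
apply: leq_trans (hG X cX); rewrite (bigD1 e) //=; exact: leq_addr.
Qed.

(** The excess, with a penalty that makes it negative on the weights other than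
    [a - 1] and [a]. *)
Definition penalized (V : finType) (a q : nat) (G : multigraph V) (e : edge V) : int :=
  excess a G e - (odd_weight a G e)%:Z * (q%:Z + 1).

Section StabilityInt.
Variables (s q a t r n : nat) (G : multigraph 'I_n).
Hypothesis a2 : (2 <= a)%N.
Hypothesis qE : (q + t = a * 'C(s, 2))%N.
Hypothesis sE : s = (r + t)%N.
Hypothesis t_bounds : (0 < t <= r)%N.
Hypothesis sn : (s <= n)%N.
Hypothesis hG : sq_graph s q G.

Let r0 : (0 < r)%N. Proof. lia. Qed.

Let u := pair_fun (excess a G).
Let f := pair_fun (penalized a q G).

Lemma weight_le e : (G e <= q)%N.
Proof. by apply: sq_graph_weight_le hG; rewrite card_ord; lia. Qed.

Lemma excess_bound x y : u x y <= q%:Z.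
Proof.
have [->|xy] := eqVneq x y; first by rewrite /u pair_fun_diag.
have [e _] := pair_funP (excess a G) xy; rewrite /u => ->.
by rewrite /excess; have := weight_le e; lia.
Qed.

Lemma penalized_cases e :
  [\/ penalized a q G e = 0 /\ G e = (a - 1)%N, penalized a q G e = 1 /\ G e = a |
      penalized a q G e < 0].
Proof.
rewrite /penalized /odd_weight /excess; have := weight_le e => h.
have [e1|n1] := eqVneq (G e) (a - 1)%N; first by apply: Or31; split => //; lia.
have [e2|n2] := eqVneq (G e) a; first by apply: Or32; split => //; lia.
by apply: Or33; rewrite /= mul1r; move: h {n1 n2}; set g := G e; lia.
Qed.

Lemma penalized_le1 x y : f x y <= 1.
Proof.
have [->|xy] := eqVneq x y; first by rewrite /f pair_fun_diag.
have [e _] := pair_funP (penalized a q G) xy; rewrite /f => ->.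
by case: (penalized_cases e) => [[->]|[->]|/ltW/le_trans->].
Qed.

Lemma penalized_le_excess x y : f x y <= u x y.
Proof.
have [->|xy] := eqVneq x y; first by rewrite /f /u !pair_fun_diag.
have [e he _] := pair_funP (penalized a q G) xy; rewrite /f /u !(pair_fun_edge _ he).
by rewrite /penalized gerBl mulr_ge0 //; lia.
Qed.

Lemma wsum_penalized_le A : wsum f A <= wsum u A.
Proof. by apply: ler_sum => x _; apply: ler_sum => y _; apply: penalized_le_excess. Qed.

Lemma wsum_full_clique (Q : {set 'I_n}) : full_clique f Q ->
  wsum f Q = #|Q|%:Z * (#|Q|%:Z - 1).
Proof.
move=> hQ; have -> : wsum f Q = \sum_(x in Q) (#|Q|%:Z - 1).
  apply: eq_bigr => x xQ; rewrite (deg_inD1 _ _ xQ) /f pair_fun_diag add0r -/f.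
  transitivity (\sum_(y in Q :\ x) (1 : int)); last first.
    by rewrite sumr_const natz (cardsD1 x Q) xQ; lia.
  by apply: eq_bigr => y; rewrite !inE => /andP[yx yQ]; apply: hQ; rewrite // eq_sym.
by rewrite sumr_const -mulr_natl natz.
Qed.

(** A set with large minimum degree yields a Turan multigraph close to [G]. The terms
    [4 r^2 q] and [r^2] bound the weight inside the sets of fewer than [2 r], respectively
    [r], vertices that are enlarged greedily, where the weights are at most [q],
    respectively one. *)
Lemma stability_min_degree (A : {set 'I_n}) (b : int) : A != finset.set0 ->
  (forall x, x \in A -> #|A|%:Z - b <= deg_in f x A) ->
  0 <= defect r A b ->
  4%:Z * r%:Z * r%:Z * q%:Z + r%:Z * r%:Z < b - defect r A b *+ 2 ->
  exists2 c : 'I_n -> 'I_r, balanced c [set: 'I_n]%SET &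
    #|[pred e | G e != color_graph c a e]|%:Z <=
      n%:Z * (defect r A b * (r%:Z *+ 2 + 1) + n%:Z - #|A|%:Z + r%:Z).
Proof.
move=> A0 degA D0 hb.
have f_sym := @pair_fun_sym _ _ (penalized a q G).
have f_diag := @pair_fun_diag _ _ (penalized a q G).
have u_sym := @pair_fun_sym _ _ (excess a G).
have u_diag := @pair_fun_diag _ _ (excess a G).
have b0 : 0 <= b := b_ge0 penalized_le1 degA A0.
have no_cl (Q : {set 'I_n}) : Q \subset A -> #|Q| = r.+1 -> ~ full_clique f Q.
  move=> QA cQ hQ; have := wsum_full_clique hQ; rewrite cQ => e1.
  have : wsum u Q < r.+1%:Z * r%:Z.
    apply: (@no_dense_set _ u u_sym u_diag r t A Q (#|A|%:Z - b) q%:Z) => //.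
    - by apply: (sq_graph_sets qE sE).
    - move=> x xA; apply: le_trans (degA x xA) _.
      by apply: ler_sum => y _; apply: penalized_le_excess.
    - exact: excess_bound.
    - move=> K /andP[K1 K2].
      have h1 : K%:Z * b <= (r%:Z *+ 2 - 1) * b by rewrite ler_wpM2r //; lia.
      have h2 : (K * K <= (2 * r) * (2 * r))%N by apply: leq_mul; lia.
      have h3 : (K * K * q <= (2 * r) * (2 * r) * q)%N by rewrite leq_mul2r h2 orbT.
      move: hb; rewrite /defect; nia.
  by have := wsum_penalized_le Q; rewrite e1; lia.
have b_large : r%:Z * r%:Z < b - defect r A b *+ 2.
  apply: le_lt_trans hb; rewrite lerDr; nia.
have [W [lab [WA cW cl mis]]] :=
  near_turan f_sym f_diag penalized_le1 r0 no_cl degA D0 b_large A0.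
have [l hl] : exists l : nat, b - defect r A b *+ 2 = l%:Z.
  by exists `|b - defect r A b *+ 2|%N; rewrite gez0_abs //; nia.
have hlW i : (l <= #|color_class lab W i|)%N by have := cl i; rewrite hl lez_nat.
have [c bal] := balanced_recolor r0 hlW.
set S := [set x in W | c x == lab x]%SET => cS.
have SW x : x \in S -> x \in W by rewrite inE => /andP[].
have mA : (#|A| <= n)%N by rewrite -[n in (_ <= n)%N]card_ord max_card.
have Sn : (#|S| <= n)%N by rewrite -[n in (_ <= n)%N]card_ord max_card.
have {}cS : #|A|%:Z - r%:Z * (defect r A b *+ 2) - r%:Z <= #|S|%:Z.
  have hm := divn_eq n r; have hj := ltn_pmod n r0.
  have e1 : r%:Z * l%:Z = #|A|%:Z + defect r A b - r%:Z * (defect r A b *+ 2).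
    by rewrite -hl /defect; ring.
  move: cS; rewrite /minn; case: ifP => _ cS; first by lia.
  have : 0 <= r%:Z * (defect r A b *+ 2) by rewrite mulr_ge0 // mulrn_wge0.
  by lia.
exists c => //.
set H := color_graph c a; pose mm e : int := (G e != H e)%:Z.
pose mf x y : int := pair_fun mm x y.
have mm01 x y : 0 <= mf x y <= 1.
  have [->|xy] := eqVneq x y; first by rewrite /mf pair_fun_diag.
  by rewrite /mf; have [e _ ->] := pair_funP mm xy; rewrite /mm; case: (_ != _).
have mmS x y : x \in S -> y \in S -> mf x y <= (f x y != (lab x != lab y)%:Z)%:Z.
  move=> xS yS; have [->|xy] := eqVneq x y; first by rewrite /mf pair_fun_diag.
  rewrite /mf; have [e he ->] := pair_funP mm xy; rewrite /f (pair_fun_edge _ he) /mm /H ffunE.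
  rewrite (bichromatic_pair c he).
  move: xS yS; rewrite !inE => /andP[_ /eqP->] /andP[_ /eqP->].
  case: (penalized_cases e) => [[-> ->]|[-> ->]|h].
  - by case: (lab x != lab y); rewrite /= ?addn0 ?eqxx //; case: (_ != _).
  - by case: (lab x != lab y); rewrite /= ?(subnK (ltnW a2)) ?eqxx //; case: (_ != _).
  - have -> : (penalized a q G e != (lab x != lab y)%:Z) by case: (lab x != lab y); lia.
    by case: (_ != _).
(* A row of a vertex of [S] only has the mismatches of [near_turan] and those with
   the vertices outside of [S]; the other rows are bounded by [n]. *)
have total : \sum_x \sum_y mf x y <=
    n%:Z * (defect r A b *+ 2 + (n%:Z - #|S|%:Z) *+ 2).
  have cSC : #|~: S|%:Z = n%:Z - #|S|%:Z by have := cardsC S; rewrite card_ord; lia.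
  have row x : x \in S -> \sum_y mf x y <= defect r A b *+ 2 + (n%:Z - #|S|%:Z).
    move=> xS; rewrite (bigID (mem S)) /=; apply: lerD.
      apply: (@le_trans _ _ #|[set y in S | f x y != (lab x != lab y)%:Z]%SET|%:Z); last first.
        apply: le_trans (mis x (SW x xS)); rewrite lez_nat; apply: subset_leq_card.
        apply/fintype.subsetP => y; rewrite inE => /andP[/SW yW hy].
        by rewrite inE yW.
      have -> : #|[set y in S | f x y != (lab x != lab y)%:Z]%SET|%:Z =
          \sum_(y in S) (f x y != (lab x != lab y)%:Z)%:Z.
        rewrite -natz -sumr_const big_mkcond [RHS]big_mkcond /=.
        by apply: eq_bigr => y _; rewrite inE; case: (y \in S); case: (_ != _).
      by apply: ler_sum => y yS; apply: mmS.
    rewrite -cSC -natz -sumr_const; rewrite [X in _ <= X](eq_bigl (fun y => y \notin S)).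
      by apply: ler_sum => y _; case/andP: (mm01 x y).
    by move=> y; rewrite finset.in_setC.
  have row' x : \sum_y mf x y <= n%:Z.
    apply: (@le_trans _ _ (\sum_(y < n) 1)).
      by apply: ler_sum => y _; case/andP: (mm01 x y).
    by rewrite sumr_const card_ord natz.
  rewrite (bigID (mem S)) /=.
  have h1 : \sum_(x in S) \sum_y mf x y <=
      #|S|%:Z * (defect r A b *+ 2 + (n%:Z - #|S|%:Z)).
    apply: le_trans (ler_sum _ row) _.
    by rewrite sumr_const -[_ *+ #|S|]mulr_natl natz.
  have h2 : \sum_(x | x \notin S) \sum_y mf x y <= (n%:Z - #|S|%:Z) * n%:Z.
    apply: le_trans (ler_sum _ (fun x _ => row' x)) _.
    rewrite (eq_bigl (mem (~: S))); last by move=> y; rewrite -finset.in_setC.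
    by rewrite sumr_const -[_ *+ #|_|]mulr_natl natz cSC.
  apply: le_trans (lerD h1 h2) _.
  have h3 : #|S|%:Z * (defect r A b *+ 2 + (n%:Z - #|S|%:Z)) <=
      n%:Z * (defect r A b *+ 2 + (n%:Z - #|S|%:Z)) by rewrite ler_wpM2r //; lia.
  by apply: le_trans (lerD h3 (lexx _)) _; rewrite le_eqVlt; apply/orP; left; apply/eqP; ring.
have eT : \sum_x \sum_y mf x y = (\sum_e mm e) *+ 2 := sum_pair_funT mm.
rewrite eT in total.
have eM : \sum_e mm e = #|[pred e | G e != H e]|%:Z.
  rewrite -[RHS]natz -sumr_const [RHS]big_mkcond /=; apply: eq_bigr => e _.
  by rewrite /mm -topredE /=; case: (_ != _).
rewrite eM in total; move: total; set M := #|[pred e | _]| => total.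
have {}total : M%:Z <= n%:Z * (defect r A b + (n%:Z - #|S|%:Z)).
  by move: total; rewrite -mulrnDl mulrnAr lerMn2r.
apply: le_trans total _; rewrite ler_wpM2l //; lia.
Qed.

End StabilityInt.

Section StabilityReal.
Variables (R : realType) (s q a t r n : nat) (G : multigraph 'I_n) (g eta : R).
Hypothesis a2 : (2 <= a)%N.
Hypothesis qE : (q + t = a * 'C(s, 2))%N.
Hypothesis sE : s = (r + t)%N.
Hypothesis t_bounds : (0 < t <= r)%N.
Hypothesis sn : (s <= n)%N.
Hypothesis hG : sq_graph s q G.

Let r0 : (0 < r)%N. Proof. lia. Qed.
Let f := pair_fun (penalized a q G).
Let c : R := 1 - r%:R^-1 - g.

Hypothesis g0 : 0 < g.
Hypothesis g1 : g * (8 * r%:R * r%:R) <= 1.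
Hypothesis etaE : eta * (8 * (q%:R + 2)) = g * g.
Hypothesis sum_close : ((turan_edges r n)%:Z - \sum_e excess a G e)%:~R <= eta * n%:R ^+ 2.
Hypothesis few_odd : #|odd_weight a G|%:R <= eta * n%:R ^+ 2.
Hypothesis n_large : 4 * (s%:R * s%:R + r%:R) <= g * g * n%:R ^+ 2.

Let rR : 1 <= r%:R :> R. Proof. by rewrite ler1n. Qed.

Let wsum_fT : (wsum f [set: 'I_n]%SET)%:~R =
  2 * ((\sum_e excess a G e)%:~R - #|odd_weight a G|%:R * (q%:R + 1)) :> R.
Proof.
rewrite wsum_pair_funT /penalized rmorphMn /= big_split /= sumrN -mulr_suml.
have -> : \sum_e (odd_weight a G e)%:Z = #|odd_weight a G|%:Z.
  rewrite -[RHS]natz -sumr_const [RHS]big_mkcond /=; apply: eq_bigr => e _.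
  by rewrite -topredE /=; case: odd_weight.
rewrite rmorphB rmorphM rmorphD /= -!pmulrn -mulr_natl.
by [].
Qed.

(** A set of maximum weight, when each of its ordered pairs costs slightly less
    than the density of the Turan graph, is almost everything and has a large
    minimum degree. *)
Lemma exists_min_degree : exists A : {set 'I_n},
  (1 - g) * n%:R <= #|A|%:R /\
  forall x, x \in A -> c * #|A|%:R - 2^-1 <= (deg_in f x A)%:~R.
Proof.
pose Phi (A : {set 'I_n}) : R := (wsum f A)%:~R - c * #|A|%:R ^+ 2.
have [A Amax] : exists A, forall B, Phi B <= Phi A.
  case: (@arg_maxP _ _ _ [set: 'I_n]%SET xpredT Phi isT) => A _ h.
  by exists A => B; apply: h.
have f_sym := @pair_fun_sym _ _ (penalized a q G).
have f_diag := @pair_fun_diag _ _ (penalized a q G).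
have ri0 : 0 < r%:R^-1 :> R by rewrite invr_gt0 ltr0n.
have ri1 : r%:R^-1 <= 1 :> R by rewrite invf_le1 // ltr0n.
have rri : r%:R * r%:R^-1 = 1 :> R by rewrite divff // pnatr_eq0 -lt0n.
exists A; split; last first.
  move=> x xA; have := Amax (A :\ x); rewrite /Phi (wsumD1 f_sym f_diag xA) -/f.
  have -> : #|A|%:R = #|A :\ x|%:R + 1 :> R by rewrite (cardsD1 x A) xA addnC natrD.
  rewrite rmorphD rmorphMn /=.
  have c1 : c <= 1 by rewrite /c; move: ri0 g0; lra.
  rewrite -[(deg_in f x A)%:~R *+ 2]mulr_natl.
  move: (deg_in f x A)%:~R (wsum f _)%:~R #|_ :\ _|%:R c1 => D w m c1 h.
  by nra.
have PhiT : g * n%:R ^+ 2 - r%:R - g * g * n%:R ^+ 2 / 4 <= Phi [set: 'I_n]%SET.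
  rewrite /Phi wsum_fT cardsT card_ord.
  have hT : (r%:R - 1) * n%:R ^+ 2 - r%:R * r%:R <= r%:R * (2 * (turan_edges r n)%:R) :> R.
    have := turan2_ge n r0; rewrite -turan_edges2 // -(ler_int R).
    by rewrite !(rmorphB, rmorphM, rmorphMn) /= -!pmulrn -[_ *+ 2]mulr_natl expr2.
  have {}hT : (1 - r%:R^-1) * n%:R ^+ 2 - r%:R <= 2 * (turan_edges r n)%:R :> R.
    rewrite -(@ler_pM2l _ r%:R) ?ltr0n //.
    apply: le_trans hT; rewrite le_eqVlt; apply/orP; left; apply/eqP.
    by rewrite mulrBr mulrA mulrBr mulr1 rri.
  move: sum_close; rewrite rmorphB /= -pmulrn => hS.
  have q0 : 0 <= q%:R + 1 :> R by rewrite addr_ge0.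
  have hB := ler_wpM2r q0 few_odd.
  rewrite /c; move: hT hS hB etaE.
  move: (\sum_e _)%:~R (#|_|%:R : R) ((turan_edges r n)%:R : R) (n%:R ^+ 2 : R) => S O E N hT hS hB hE.
  have -> : g * g * N = eta * (8 * (q%:R + 2)) * N by rewrite hE.
  by nra.
have PhiA : Phi A <= g * #|A|%:R ^+ 2 + s%:R * s%:R.
  rewrite /Phi; have [hs|hs] := leqP s #|A|.
    have h : (wsum f A)%:~R <= (1 - r%:R^-1) * #|A|%:R ^+ 2 :> R.
      have h1 : wsum f A <= turan2 r #|A|.
        apply: le_trans (wsum_le_turan a2 qE sE t_bounds sn hG hs).
        exact: wsum_penalized_le.
      rewrite -(@ler_pM2l _ r%:R) ?ltr0n // mulrA mulrBr mulr1 rri.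
      have : (r%:Z * wsum f A)%:~R <= ((r%:Z - 1) * (#|A|%:Z * #|A|%:Z))%:~R :> R.
        by rewrite ler_int; apply: le_trans (turan2_le #|A| r0); rewrite ler_wpM2l.
      by rewrite !(rmorphM, rmorphB) /= -!pmulrn expr2.
    have s0 : 0 <= s%:R * s%:R :> R by rewrite mulr_ge0.
    rewrite /c; move: (wsum f A)%:~R (#|A|%:R ^+ 2) h s0 => w m h s0.
    by nra.
  have h : (wsum f A)%:~R <= s%:R * s%:R :> R.
    have h1 : wsum f A <= #|A|%:Z * (#|A|%:Z - 1).
      apply: wsum_le_le1 => // x y _ _ _; exact: (penalized_le1 a2 qE sE t_bounds sn hG).
    have : wsum f A <= s%:Z * s%:Z by apply: le_trans h1 _; move: hs; clear; nia.
    by rewrite -(ler_int R) rmorphM /= -!pmulrn.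
  have c0 : - g <= c by rewrite /c; move: ri1; lra.
  have m0 : 0 <= #|A|%:R ^+ 2 :> R by rewrite exprn_ge0.
  move: (wsum f A)%:~R (#|A|%:R ^+ 2) h m0 c0 => w m h m0 c0.
  by nra.
have h := le_trans PhiT (le_trans (Amax _) PhiA).
have g8 : g <= 1 by move: rR g1 g0; nra.
rewrite -ler_sqr ?nnegrE ?mulr_ge0 ?subr_ge0 //.
have h2 : g * (n%:R ^+ 2 * (1 - g / 2)) <= g * #|A|%:R ^+ 2.
  move: h n_large; move: (n%:R ^+ 2 : R) (#|A|%:R ^+ 2 : R) (s%:R * s%:R : R) (r%:R : R) => N m ss rr h hn.
  by nra.
rewrite (ler_pM2l g0) in h2; apply: le_trans h2.
rewrite exprMn mulrC ler_wpM2l ?exprn_ge0 //.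
have gg : g * g <= g by apply: ler_piMr => //; exact: ltW.
by rewrite expr2; move: gg g0; lra.
Qed.

Variable delta : R.
Hypothesis gd : g * (8 * r%:R * r%:R) <= delta.
Hypothesis n_large2 : 16 * r%:R * r%:R * r%:R * (q%:R + 1) <= n%:R :> R.
Hypothesis n_large3 : 8 * r%:R * r%:R <= delta * n%:R.

(** Stability in terms of the sum of the weights and of the number of weights other
    than [a - 1] and [a]. *)
Lemma stability_from_sum : exists2 d : 'I_n -> 'I_r, balanced d [set: 'I_n]%SET &
  #|[pred e | G e != color_graph d a e]|%:R <= delta * n%:R ^+ 2.
Proof.
have [A [mn degA]] := exists_min_degree.
have mle : #|A|%:R <= n%:R :> R by rewrite ler_nat -[n in (_ <= n)%N]card_ord max_card.
(* The least integer greater than [(1 / r + g) * #|A|]: the defect is then between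
   [r * g * #|A|] and [r * g * #|A| + r]. *)
pose b := Num.floor ((r%:R^-1 + g) * #|A|%:R + 1).
have bu : b%:~R <= (r%:R^-1 + g) * #|A|%:R + 1 by apply: floor_le.
have bl : (r%:R^-1 + g) * #|A|%:R < b%:~R.
  by have := floorD1_gt ((r%:R^-1 + g) * #|A|%:R + 1); rewrite -/b rmorphD /= ltrD2r.
have degA' x : x \in A -> #|A|%:Z - b <= deg_in f x A.
  move=> xA; rewrite lerBlDr -lerBlDl floor_ge_int rmorphB /= -pmulrn.
  by have := degA x xA; rewrite /c; lra.
have ri0 : 0 < r%:R^-1 :> R by rewrite invr_gt0 ltr0n.
have rri : r%:R * r%:R^-1 = 1 :> R by rewrite divff // pnatr_eq0 -lt0n.
have rr1 : r%:R <= r%:R * r%:R :> R by rewrite ler_peMl // ltW // (lt_le_trans ltr01).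
have q0 : 0 <= q%:R :> R by [].
have thE : (defect r A b)%:~R = r%:R * b%:~R - #|A|%:R :> R.
  by rewrite /defect rmorphB rmorphM /= -!pmulrn.
have m0 : 0 <= #|A|%:R :> R by [].
have n0 : 0 < n%:R :> R.
  apply: lt_le_trans n_large2; rewrite !mulr_gt0 ?ltr0n //; lra.
move: thE; set th := (defect r A b)%:~R => thE.
have gr8 : 8 * r%:R * g <= r%:R^-1.
  have e : g * (8 * r%:R * r%:R) * r%:R^-1 = 8 * r%:R * g * (r%:R * r%:R^-1) by ring.
  by have := ler_wpM2r (ltW ri0) g1; rewrite mul1r e rri mulr1.
have g18 : g <= 8^-1.
  move: rR g1 g0; set rho := r%:R => h1 h2 h3.
  have : 1 <= rho * rho by nra.
  by nra.
have thl : r%:R * g * #|A|%:R < th.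
  rewrite thE ltrBrDr -(@ltr_pM2l _ r%:R) ?ltr0n // in bl *.
  by move: bl; rewrite mulrA mulrDr rri; lra.
have thu : th <= r%:R * g * #|A|%:R + r%:R.
  have r00 : 0 <= r%:R :> R by [].
  have := ler_wpM2l r00 bu; rewrite thE mulrDr mulrA mulrDr rri; lra.
have D0 : 0 <= defect r A b.
  rewrite -(ler_int R) -/th; apply: ltW; apply: le_lt_trans thl.
  by rewrite !mulr_ge0 // ltW.
have A0 : A != finset.set0.
  apply: contraTneq mn => ->; rewrite cards0 -ltNge mulr_gt0 //; lra.
have hb : 4%:Z * r%:Z * r%:Z * q%:Z + r%:Z * r%:Z < b - defect r A b *+ 2.
  rewrite -(ltr_int R) !(rmorphB, rmorphD, rmorphM, rmorphMn) /= -/th -!pmulrn.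
  rewrite -thE.
  have h1 := ler_wpM2r m0 gr8.
  have h2 : 16 * r%:R * r%:R * (q%:R + 1) <= n%:R * r%:R^-1 :> R.
    rewrite -(@ler_pM2l _ r%:R) ?ltr0n // [X in _ <= X]mulrCA rri mulr1.
    by apply: le_trans n_large2; rewrite le_eqVlt; apply/orP; left; apply/eqP; ring.
  have h3 : (1 - g) * n%:R * r%:R^-1 <= #|A|%:R * r%:R^-1 by rewrite ler_wpM2r // ltW.
  have h4 : 7 / 8 * (n%:R * r%:R^-1) <= (1 - g) * n%:R * r%:R^-1.
    by rewrite -[X in _ <= X]mulrA ler_wpM2r //; lra.
  have h5 : 0 <= r%:R * r%:R * q%:R :> R by rewrite !mulr_ge0.
  have h6 : 0 <= g * #|A|%:R by rewrite mulr_ge0 // ltW.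
  move: bl thu h1 h2 h3 h4 h5 h6 rr1 rR.
  by lra.
have [d bal hM] := stability_min_degree a2 qE sE t_bounds sn hG A0 degA' D0 hb.
exists d => //.
have {}hM : #|[pred e | G e != color_graph d a e]|%:R <=
    n%:R * (th * (2 * r%:R + 1) + n%:R - #|A|%:R + r%:R).
  move: hM; rewrite -(ler_int R) /th; move: (defect r A b) => D hM.
  apply: le_trans hM _; rewrite le_eqVlt; apply/orP; left; apply/eqP.
  by rewrite !(rmorphB, rmorphD, rmorphM, rmorphMn) /= -!pmulrn; ring.
apply: le_trans hM _; rewrite expr2 mulrCA ler_wpM2l //.
have h1 : th * (2 * r%:R + 1) <= (r%:R * g * n%:R + r%:R) * (3 * r%:R).
  apply: ler_pM; [by rewrite -/th ler0z | by rewrite addr_ge0 ?mulr_ge0 | | by move: rR; lra].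
  apply: le_trans thu _; rewrite lerD2r ler_wpM2l // mulr_ge0 // ltW //.
have h2 := ler_wpM2r (ltW n0) gd.
have h3 : g * n%:R <= r%:R * r%:R * (g * n%:R).
  by rewrite ler_peMl ?(le_trans rR rr1) // mulr_ge0 // ltW.
move: h1 h2 h3 n_large3 mn rr1; lra.
Qed.

End StabilityReal.

(** All edges of a Turan multigraph have weight at most [a]. *)
Lemma ln_turan_prod_le (R : realType) (r a n : nat) : (0 < r)%N -> (2 <= a)%N ->
  ln (turan_prod r a n)%:R <= n%:R ^+ 2 * ln a%:R :> R.
Proof.
move=> r0 a2.
have la : 0 <= ln a%:R :> R by rewrite ln_ge0 // ler1n ltnW.
apply: (@le_trans _ _ (ln (a ^ 'C(n, 2))%N%:R)).
  rewrite ler_ln ?posrE ?ltr0n ?turan_prod_gt0 ?expn_gt0 ?(ltnW a2) //.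
  rewrite ler_nat /turan_prod -{2}(subnK (turan_edges_le n r0)) expnD.
  apply: leq_mul => //; case: ('C(n, 2) - _)%N => [//|k].
  by rewrite leq_exp2r // leq_subr.
rewrite natrX lnXn ?ltr0n ?(ltnW a2) // -[ln _ *+ _]mulr_natl ler_wpM2r //.
rewrite -natrX ler_nat; have := bin2_mul2 n; rewrite expnS expn1; nia.
Qed.

Lemma stability (R : realType) (s q a t r : nat) (delta : R) :
  (2 <= a)%N -> (q + t = a * 'C(s, 2))%N -> s = (r + t)%N -> (0 < t <= r)%N ->
  0 < delta ->
  exists (M : nat) (eps : R), 0 < eps /\
    forall (n : nat) (G : multigraph 'I_n), (M < n)%N -> sq_graphs n s q G ->
      (ex_prod n s q)%:R `^ (1 - eps) < (edge_prod G)%:R ->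
      exists H : multigraph 'I_n,
        turan_multigraphs r a n H /\ delta_close delta G H.
Proof.
move=> a2 qE sE tr d0; have r0 : (0 < r)%N by lia.
have rR : 1 <= r%:R :> R by rewrite ler1n.
have r8 : 0 < 8 * r%:R * r%:R :> R by rewrite !mulr_gt0 // ltr0n.
have r8n := lt0r_neq0 r8.
pose m1 := Num.min 1 delta.
have m10 : 0 < m1 by rewrite lt_min ltr01.
pose g := m1 / (8 * r%:R * r%:R).
have g0 : 0 < g by rewrite divr_gt0.
have gE : g * (8 * r%:R * r%:R) = m1 by rewrite /g divfK.
have g1 : g * (8 * r%:R * r%:R) <= 1 by rewrite gE ge_min lexx.
have gd : g * (8 * r%:R * r%:R) <= delta by rewrite gE ge_min lexx orbT.
have q8 : 0 < 8 * (q%:R + 2) :> R by rewrite mulr_gt0 // ltr_wpDl.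
pose eta := g * g / (8 * (q%:R + 2)).
have eta0 : 0 < eta by rewrite divr_gt0 // mulr_gt0.
have etaE : eta * (8 * (q%:R + 2)) = g * g by rewrite /eta divfK // lt0r_neq0.
have lr := ln_wratio_gt0 R a2; have ll := ln_wloss_lt0 R a2.
(* The deficit of the logarithm is less than [eps] times that of the extremal number,
   hence at most [eta * L * n ^ 2] by the choice of [eps]. *)
pose L := Num.min (ln (wratio R a)) (- ln (wloss R a)).
have L0 : 0 < L by rewrite lt_min lr oppr_gt0.
have la : 0 < ln a%:R :> R by rewrite ln_gt0 // ltr1n.
pose eps := eta * L / ln a%:R.
have eps0 : 0 < eps by rewrite divr_gt0 // mulr_gt0.
have epsE : eps * ln a%:R = eta * L by rewrite /eps divfK // lt0r_neq0.
pose K1 : R := 4 * (s%:R * s%:R + r%:R) / (g * g).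
pose K2 : R := 16 * r%:R * r%:R * r%:R * (q%:R + 1).
pose K3 : R := 8 * r%:R * r%:R / delta.
have K10 : 0 <= K1.
  by rewrite divr_ge0 ?mulr_ge0 ?addr_ge0 ?mulr_ge0 // ltW.
have K20 : 0 <= K2 by rewrite !mulr_ge0 // addr_ge0.
have K30 : 0 <= K3 by rewrite divr_ge0 ?mulr_ge0 // ltW.
exists (s + Num.bound (K1 + K2 + K3))%N, eps; split => // n G Mn hG hP.
have sn : (s <= n)%N by apply: leq_trans (ltnW Mn); apply: leq_addr.
have Kn : K1 + K2 + K3 <= n%:R.
  apply: ltW; apply: lt_le_trans (archi_boundP _) _; first by rewrite !addr_ge0.
  by rewrite ler_nat; apply: leq_trans (ltnW Mn); apply: leq_addl.
have n1 : 1 <= n%:R :> R by rewrite ler1n; apply: leq_ltn_trans Mn.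
have nn : n%:R <= n%:R ^+ 2 :> R by rewrite expr2 ler_peMl // ltW // (lt_le_trans ltr01).
have P0 : (0 < edge_prod G)%N by rewrite -(ltr0n R); apply: le_lt_trans hP; apply: powR_ge0.
have def := ln_edge_prod_deficit R a2 qE sE tr sn hG P0.
have ex0 : 0 < (turan_prod r a n)%:R :> R by rewrite ltr0n turan_prod_gt0.
rewrite (ex_prodE R a2 qE sE tr sn) in hP.
have p0 : 0 < (turan_prod r a n)%:R `^ (1 - eps) :> R by apply: powR_gt0.
have P0R : 0 < (edge_prod G)%:R :> R by rewrite ltr0n.
have {hP} : ln ((turan_prod r a n)%:R `^ (1 - eps)) < ln ((edge_prod G)%:R : R).
  by rewrite ltr_ln ?posrE.
rewrite ln_powR => hP.
have hex := ln_turan_prod_le R n r0 a2.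
have deficit : ln (turan_prod r a n)%:R - ln (edge_prod G)%:R <= L * (eta * n%:R ^+ 2) :> R.
  have := ler_wpM2l (ltW eps0) hex; rewrite mulrCA epsE; move: hP; lra.
have sum0 : 0 <= ((turan_edges r n)%:Z - \sum_e excess a G e)%:~R :> R.
  by rewrite ler0z subr_ge0; apply: (sum_excess_le a2 qE sE tr sn hG).
have odd0 : 0 <= #|odd_weight a G|%:R :> R by [].
have L1 : L <= ln (wratio R a) by rewrite ge_min lexx.
have L2 : L <= - ln (wloss R a) by rewrite ge_min lexx orbT.
have h1 := ler_wpM2l sum0 L1; have h2 := ler_wpM2l odd0 L2.
have sum_close : ((turan_edges r n)%:Z - \sum_e excess a G e)%:~R <= eta * n%:R ^+ 2.
  rewrite -(ler_pM2l L0); apply: le_trans deficit; apply: le_trans def.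
  rewrite mulrC; apply: le_trans h1 _; rewrite lerDl.
  by apply: le_trans h2; rewrite mulr_ge0 // ltW.
have few_odd : #|odd_weight a G|%:R <= eta * n%:R ^+ 2.
  rewrite -(ler_pM2l L0); apply: le_trans deficit; apply: le_trans def.
  rewrite mulrC; apply: le_trans h2 _; rewrite lerDr.
  by apply: le_trans h1; rewrite mulr_ge0 // ltW.
have K1n : K1 <= n%:R by apply: le_trans Kn; rewrite -addrA lerDl addr_ge0.
have nl2 : K2 <= n%:R by apply: le_trans Kn; rewrite addrAC lerDr addr_ge0.
have K3n : K3 <= n%:R by apply: le_trans Kn; rewrite lerDr addr_ge0.
have nl1 : 4 * (s%:R * s%:R + r%:R) <= g * g * n%:R ^+ 2.
  have gg0 : 0 < g * g by rewrite mulr_gt0.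
  by rewrite [leRHS]mulrC -ler_pdivrMr //; apply: le_trans K1n nn.
have nl3 : 8 * r%:R * r%:R <= delta * n%:R.
  by rewrite [leRHS]mulrC -ler_pdivrMr.
have [d bal hd] := stability_from_sum a2 qE sE tr sn hG g0 g1 etaE sum_close few_odd nl1 gd nl2 nl3.
exists (color_graph d a); split; last by rewrite /delta_close card_ord.
apply/turan_multigraphsP; [exact: ltnW | | by exists d].
by rewrite r0 (leq_trans _ sn) // sE leq_addr.
Qed.

Local Open Scope classical_set_scope.
Local Open Scope ring_scope.

Theorem theorem4 (R : realType) (s q a t : nat)
  (a_ge2 : (2 <= a)%N)
  (qE : (q + t = a * 'C(s, 2))%N)
  (st : ((2 <= s)%N /\ t = 1%N) \/
        [/\ (4 <= s)%N, (2 <= t)%N & (2 * t <= s)%N]) :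
  (* Extremal *)
  [/\ forall n : nat, (s <= n)%N ->
        turan_multigraphs (s - t) a n `<=` extremal_graphs n s q /\
        (ex_prod n s q)%:R =
          (a%:R - 1) ^+ 'C(n, 2) *
          (a%:R / (a%:R - 1)) ^+ turan_edges (s - t) n :> R,
      cvgn (ex_prod_root R s q) /\
        ex_prod_lim R s q =
          (a%:R - 1) *
          (a%:R / (a%:R - 1)) `^ ((s%:R - t%:R - 1) / (s%:R - t%:R)),
      (2 <= s)%N /\ t = 1%N -> forall n : nat, (s <= n)%N ->
        extremal_graphs n s q = turan_multigraphs (s - t) a n &
      [/\ (4 <= s)%N, (2 <= t)%N & (2 * t <= s)%N] ->
        exists N : nat, forall n : nat, (N <= n)%N ->
        extremal_graphs n s q = turan_multigraphs (s - t) a n]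
  /\
  (* Stability *)
  (forall delta : R, 0 < delta ->
     exists (M : nat) (eps : R), 0 < eps /\
       forall (n : nat) (G : multigraph 'I_n), (M < n)%N ->
         sq_graphs n s q G ->
         (ex_prod n s q)%:R `^ (1 - eps) < (edge_prod G)%:R ->
         exists H : multigraph 'I_n,
           turan_multigraphs (s - t) a n H /\ delta_close delta G H).
Proof.
have [r [sE tr]] : exists r, s = (r + t)%N /\ (0 < t <= r)%N.
  by exists (s - t)%N; case: st => [[? ?]|[? ? ?]]; lia.
have -> : (s - t = r)%N by lia.
split; last by move=> delta d0; exact: stability a_ge2 qE sE tr d0.
split.
- move=> n sn; split; first exact: (turan_extremal R a_ge2 qE sE tr sn).
  by rewrite (ex_prodE R a_ge2 qE sE tr sn) turan_prodE //; lia.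
- have -> : s%:R - t%:R = r%:R :> R by rewrite sE natrD addrK.
  have h := @cvg_ex_prod_root R s q a t r a_ge2 qE sE tr.
  by split; [exact: cvgP h | apply: cvg_lim].
- move=> [_ t1] n sn; apply/seteqP; split; last exact: (turan_extremal R a_ge2 qE sE tr sn).
  by move=> G; apply: (extremal_turan1 R a_ge2 qE sE tr sn t1).
- move=> _; exists (s + 10 * r ^ 3).+1%N => n n_large.
  have sn : (s <= n)%N by lia.
  apply/seteqP; split; last exact: (turan_extremal R a_ge2 qE sE tr sn).
  by move=> G; apply: (extremal_turan_large R a_ge2 qE sE tr sn).
Qed.
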